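(* Let $n$ be a positive integer, and let $I_{2n}$ denote the set of all $2n+1$ possible insertions of the number $2$ in the string $\{\underbrace{3,1,\ldots,3,1}_{2n}\}$. Then $$\sum_{\vec{s}_{2n}\in I_{2n}}\zeta^{*}(\vec{s}_{2n})=\sum_{k=0}^{n}\left\{\frac{2^{4k+3}B_{4k+2}}{(4k+2)!}\sum_{i=0}^{n-k}\frac{\alpha_{n-k-i}}{(4i+2)!}-\frac{\alpha_{n-k}}{(4k+3)!}\right\}\pi^{4n+2},$$ where, for every integer $N\ge 0$, $$\alpha_{N}=\sum_{\substack{n_{0}+n_{1}=2N\\ n_{0},n_{1}\geq 0}}(-1)^{n_{1}}\frac{(2^{2n_{0}}-2)B_{2n_{0}}}{(2n_{0})!}\,\frac{(2^{2n_{1}}-2)B_{2n_{1}}}{(2n_{1})!}$$ (sum over pairs of nonnegative integers). In particular, $\sum_{\vec{s}_{2n}\in I_{2n}}\zeta^{*}(\vec{s}_{2n})$ is a rational multiple of $\pi^{4n+2}$.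
   Context: For positive integers $k_1,\ldots,k_r$ with $k_1\geq 2$, the multiple zeta-star value is the convergent series $$\zeta^*(k_1,\ldots,k_r)=\sum_{m_1\geq m_2\geq\cdots\geq m_r>0}\frac{1}{m_1^{k_1}m_2^{k_2}\cdots m_r^{k_r}},$$ the sum being over positive integers $m_1,\dots,m_r$. The string $\{\underbrace{3,1,\ldots,3,1}_{2n}\}$ is the sequence of length $2n$ in which the block $3,1$ is repeated $n$ times; an element $\vec{s}_{2n}$ of $I_{2n}$ is a sequence of length $2n+1$ obtained by inserting a single entry $2$ at one of the $2n+1$ positions of this string (including before the first entry and after the last entry). $B_{2j}$ ($j\ge 0$) denotes the classical Bernoulli numbers, defined by $\frac{t}{e^t-1}=\sum_{j\ge0}B_j\frac{t^j}{j!}$ (so $B_0=1$, $B_2=1/6$, $B_4=-1/30$). *)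

(* Defs.v *)
From HB Require Import structures.
From mathcomp Require Import all_boot all_order all_algebra.
From mathcomp Require Import all_classical all_reals all_analysis.

Set Implicit Arguments.
Unset Strict Implicit.
Unset Printing Implicit Defensive.

Import Order.TTheory GRing.Theory Num.Theory.
Import numFieldNormedType.Exports.

Local Open Scope classical_set_scope.
Local Open Scope ring_scope.

(* An index (m_1, ..., m_r) is a list. The sum is unordered and takes values
   in \bar R; since its terms are nonnegative, it equals a real number exactly
   when the series converges (to that number). *)
Definition zeta_star (R : realType) (k : seq nat) : \bar R :=
  \esum_(m in [set m : seq nat |
                 [/\ size m = size k, sorted geq m & all (leq 1) m]])
    (\prod_(i < size k) (nth 0%N m i)%:R ^- nth 0%N k i)%:E.

Definition string31 (n : nat) : seq nat := flatten (nseq n [:: 3; 1]%N).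

Definition insertions2 (s : seq nat) : seq (seq nat) :=
  [seq take p s ++ 2%N :: drop p s | p <- iota 0 (size s).+1].

(* Summing over the list [insertions2 (string31 n)] is summing over the set of
   its elements: it has 2n+1 entries, and they are pairwise distinct. *)
Lemma size_insertions2 (n : nat) :
  size (insertions2 (string31 n)) = (2 * n).+1.
Proof.
by rewrite size_map size_iota /string31; congr S; elim: n => //= n ->; rewrite mulnS.
Qed.

Lemma uniq_insertions2 (n : nat) : uniq (insertions2 (string31 n)).
Proof.
have two_notin : 2%N \notin string31 n by rewrite /string31; elim: n.
rewrite map_inj_in_uniq ?iota_uniq // => p q.
rewrite !mem_iota !add0n !ltnS /= => ps qs /(congr1 (index 2%N)).
have idx r : (r <= size (string31 n))%N ->
    index 2%N (take r (string31 n) ++ 2%N :: drop r (string31 n)) = r.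
  move=> rs; rewrite index_cat ifN /= ?addn0 ?size_takel //.
  by apply: contra two_notin; exact: mem_take.
by rewrite !idx.
Qed.

(* t / (e^t - 1) = \sum_(j >= 0) B_j t^j / j! for all t <> 0 near 0, which
   determines B. *)
Definition bernoulli_numbers (R : realType) (B : nat -> R) : Prop :=
  \forall t \near (0 : R)^',
    pseries (fun j => B j / j`!%:R) t @ \oo --> t / (expR t - 1).

Definition alpha (R : realType) (B : nat -> R) (N : nat) : R :=
  \sum_(n0 < (2 * N).+1) \sum_(n1 < (2 * N).+1 | (n0 + n1 == 2 * N)%N)
    (-1) ^+ n1 * ((2 ^+ (2 * n0) - 2) * B (2 * n0)%N / (2 * n0)`!%:R)
               * ((2 ^+ (2 * n1) - 2) * B (2 * n1)%N / (2 * n1)`!%:R).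

(* Main.v *)
Require Import Defs.
From HB Require Import structures.
From mathcomp Require Import all_boot all_order all_algebra.
From mathcomp Require Import all_classical all_reals all_analysis.
From mathcomp Require Import ring lra zify.

Set Implicit Arguments.
Unset Strict Implicit.
Unset Printing Implicit Defensive.

Import Order.TTheory GRing.Theory Num.Theory.
Import numFieldNormedType.Exports.

Local Open Scope ring_scope.

(** Let [Z_m] be the two-by-two matrix with entries [x ^ 3 / m ^ 3] and [x / m] off
    the diagonal, which reads a letter 3 or 1 at the level [m]. A strict sum over
    words [3,1,3,1,...] is an entry of an ordered product of the matrices [1 + Z_m],
    a star sum one of an ordered product of the [(1 - Z_m) ^ -1]. Since [Z_m ^ 2] is
    the scalar [x ^ 4 / m ^ 4], the latter is [(1 + Z_m) / det_m] with
    [det_m = 1 - x ^ 4 / m ^ 4]: star sums are strict sums divided by the product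
    [D] of all [det_m]. The letter 2 leaves the alternation of 3 and 1 undisturbed, so
    that inserting it amounts to inserting the scalar [x ^ 2 / m ^ 2], and a short
    computation gives the generating function of the theorem, at every truncation
    level ([strict_starCD]):

      [D * (star insertions) = 2 h * (strict sums) - (strict insertions)],
      [h = sum_m (x ^ 2 / m ^ 2) / det_m].

    Each factor has a closed form.

    - [D = prod_m (1 - x ^ 2 / m ^ 2) (1 + x ^ 2 / m ^ 2)] is a product of a sine and
      a hyperbolic sine by Euler's product ([euler_product]); its inverse is, by the
      definition of the Bernoulli numbers, the generating series of the
      [alpha_N pi ^ 4N].
    - [h] generates the values [zeta (4k + 2)], which come from the logarithmic
      derivative of Euler's product.
    - The strict sums [zeta ({3,1}^n)] are [2 pi ^ 4n / (4n + 2)!] and the strict sums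
      over the insertions of 2 are [pi ^ (4n + 2) / (4n + 3)!] ([strictA_cvg],
      [strictC_cvg]). Both follow from a factorization of the corresponding
      multiple polylogarithms: for [x ^ 4 = 4 u v] and the weight [- (u + v)] on the
      letter 2, their generating function is [F_u F_v], where
      [F_u = 2F1(a, -a; 1; t)] with [a ^ 2 = u], because both sides solve the same
      linear differential system. At [t = 1] the function [F_u] is Euler's product
      again, and only the terms of degree at most one in [u + v] matter.

    All identities are proved between formal power series, the analytic input being
    the coefficientwise convergence of the truncations. The convergence of the star
    sums comes for free: their coefficients are obtained from convergent ones by
    dividing by [D], whose constant term is 1 ([coef_cvg_div]). *)

(** * Formal power series *)

Record fps (A : Type) := Fps { fcoef :> nat -> A }.

Lemma fpsP (A : Type) (f g : fps A) : (forall n, f n = g n) -> f = g.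
Proof. by case: f g => f [g] /= fg; congr Fps; apply/funext. Qed.

HB.instance Definition _ (A : Type) := gen_eqMixin (fps A).
HB.instance Definition _ (A : Type) := gen_choiceMixin (fps A).

Section FpsZmod.
Variable A : zmodType.
Implicit Types f g h : fps A.

Definition fzero : fps A := Fps (fun _ => 0).
Definition fopp f : fps A := Fps (fun n => - f n).
Definition fadd f g : fps A := Fps (fun n => f n + g n).

Lemma faddA : associative fadd.
Proof. by move=> f g h; apply: fpsP => n /=; rewrite addrA. Qed.
Lemma faddC : commutative fadd.
Proof. by move=> f g; apply: fpsP => n /=; rewrite addrC. Qed.
Lemma fadd0 : left_id fzero fadd.
Proof. by move=> f; apply: fpsP => n /=; rewrite add0r. Qed.
Lemma faddN : left_inverse fzero fopp fadd.
Proof. by move=> f; apply: fpsP => n /=; rewrite addNr. Qed.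

HB.instance Definition _ := GRing.isZmodule.Build (fps A) faddA faddC fadd0 faddN.

Lemma fps0E n : (0 : fps A) n = 0. Proof. by []. Qed.
Lemma fpsDE f g n : (f + g) n = f n + g n. Proof. by []. Qed.
Lemma fpsNE f n : (- f) n = - f n. Proof. by []. Qed.
Lemma fpsBE f g n : (f - g) n = f n - g n. Proof. by []. Qed.
Lemma fpsMnE f m n : (f *+ m) n = f n *+ m.
Proof. by elim: m => [|m IH]; rewrite ?mulr0n // !mulrS fpsDE IH. Qed.
Lemma fps_sumE I (r : seq I) (P : pred I) (F : I -> fps A) n :
  (\sum_(i <- r | P i) F i) n = \sum_(i <- r | P i) F i n.
Proof. by elim/big_rec2: _ => // i y1 y2 _ <-. Qed.

End FpsZmod.

Section FpsRing.
Variable A : comNzRingType.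
Implicit Types f g h : fps A.

Definition fone : fps A := Fps (fun n => (n == 0)%:R).
Definition fmul f g : fps A := Fps (fun n => \sum_(i < n.+1) f i * g (n - i)%N).

(** Below a fixed degree the Cauchy product is a product of polynomials, from
    which the ring axioms are inherited. *)
Definition ftrunc N f : {poly A} := \poly_(i < N.+1) f i.

Lemma coef_ftrunc N f i : (i <= N)%N -> (ftrunc N f)`_i = f i.
Proof. by move=> iN; rewrite coef_poly ltnS iN. Qed.

Lemma fmul_trunc N f g n : (n <= N)%N ->
  fmul f g n = (ftrunc N f * ftrunc N g)`_n.
Proof.
move=> nN; rewrite coefM; apply: eq_bigr => i _.
by rewrite !coef_ftrunc //; have := ltn_ord i; lia.
Qed.

Lemma fmulC : commutative fmul.
Proof. by move=> f g; apply: fpsP => n; rewrite !(fmul_trunc _ _ (leqnn n)) mulrC. Qed.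

Lemma fmulA : associative fmul.
Proof.
move=> f g h; apply: fpsP => n.
transitivity ((ftrunc n f * (ftrunc n g * ftrunc n h))`_n).
  rewrite coefM; apply: eq_bigr => i _.
  by rewrite coef_ftrunc ?(fmul_trunc (N := n)) //; have := ltn_ord i; lia.
rewrite mulrA coefM; apply: eq_bigr => i _.
by rewrite (@coef_ftrunc _ h) ?(fmul_trunc (N := n)) //; have := ltn_ord i; lia.
Qed.

Lemma fmul1 : left_id fone fmul.
Proof.
move=> f; apply: fpsP => n /=; rewrite big_ord_recl /= subn0 mul1r big1 ?addr0 //.
by move=> i _; rewrite mul0r.
Qed.

Lemma fmulDl : left_distributive fmul +%R.
Proof.
move=> f g h; apply: fpsP => n; rewrite fpsDE /= -big_split /=.
by apply: eq_bigr => i _; rewrite mulrDl.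
Qed.

Lemma fone_neq0 : fone != 0.
Proof. by apply/eqP => /(congr1 (fun f => fcoef f 0%N)) /eqP; rewrite fps0E oner_eq0. Qed.

HB.instance Definition _ := GRing.Zmodule_isComNzRing.Build (fps A)
  fmulA fmulC fmul1 fmulDl fone_neq0.

Lemma fpsME f g n : (f * g) n = \sum_(i < n.+1) f i * g (n - i)%N. Proof. by []. Qed.

Lemma fpsM0E f g : (f * g) 0%N = f 0%N * g 0%N.
Proof. by rewrite fpsME big_ord_recl big_ord0 addr0. Qed.

Definition fconst (a : A) : fps A := Fps (fun n => if n == 0%N then a else 0).

Definition fX : fps A := Fps (fun n => (n == 1)%:R).

Lemma fpsCME a f n : (fconst a * f) n = a * f n.
Proof.
rewrite fpsME big_ord_recl /= subn0 big1 ?addr0 // => i _.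
by rewrite mul0r.
Qed.

Lemma fconst_is_zmod_morphism : zmod_morphism fconst.
Proof. by move=> a b; apply: fpsP => -[|n] //=; rewrite subr0. Qed.
HB.instance Definition _ :=
  GRing.isZmodMorphism.Build A (fps A) fconst fconst_is_zmod_morphism.

Lemma fconst_is_monoid_morphism : monoid_morphism fconst.
Proof.
split; first by apply: fpsP => -[|n].
by move=> a b; apply: fpsP => -[|n]; rewrite fpsCME //= mulr0.
Qed.
HB.instance Definition _ :=
  GRing.isMonoidMorphism.Build A (fps A) fconst fconst_is_monoid_morphism.

Lemma fconst1 : fconst 1 = 1. Proof. exact: rmorph1. Qed.
Lemma fconstN a : fconst (- a) = - fconst a. Proof. exact: rmorphN. Qed.

Lemma fpsXM0 f : (fX * f) 0%N = 0.
Proof. by rewrite fpsM0E mul0r. Qed.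

Lemma fpsXMS f n : (fX * f) n.+1 = f n.
Proof.
rewrite fpsME big_ord_recl big_ord_recl /= mul0r add0r /bump /= subn1 mul1r.
by rewrite big1 ?addr0 // => i _; rewrite mul0r.
Qed.

(** The Euler operator [X d/dX]; unlike [d/dX] it does not shift degrees. *)
Definition theta f : fps A := Fps (fun n => f n *+ n).

Lemma thetaE f n : theta f n = f n *+ n. Proof. by []. Qed.

Lemma theta_is_zmod_morphism : zmod_morphism theta.
Proof. by move=> f g; apply: fpsP => n /=; rewrite mulrnBl. Qed.
HB.instance Definition _ :=
  GRing.isZmodMorphism.Build (fps A) (fps A) theta theta_is_zmod_morphism.

Lemma thetaD f g : theta (f + g) = theta f + theta g. Proof. exact: raddfD. Qed.
Lemma thetaB f g : theta (f - g) = theta f - theta g. Proof. exact: raddfB. Qed.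
Lemma thetaN f : theta (- f) = - theta f. Proof. exact: raddfN. Qed.

Lemma thetaM f g : theta (f * g) = theta f * g + f * theta g.
Proof.
apply: fpsP => n; rewrite fpsDE /= -sumrMnl -big_split /=; apply: eq_bigr => i _.
by rewrite mulrnAl mulrnAr -mulrnDr subnKC // -ltnS.
Qed.

Lemma theta_const a : theta (fconst a) = 0.
Proof. by apply: fpsP => -[|n] /=; rewrite ?mulr0n ?mul0rn. Qed.

Lemma theta_constM a f : theta (fconst a * f) = fconst a * theta f.
Proof. by rewrite thetaM theta_const mul0r add0r. Qed.

Definition fderiv f : fps A := Fps (fun n => f n.+1 *+ n.+1).

Lemma fderivE f n : fderiv f n = f n.+1 *+ n.+1. Proof. by []. Qed.

Lemma fX_deriv f : fX * fderiv f = theta f.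
Proof. by apply: fpsP => -[|n]; rewrite ?fpsXM0 ?fpsXMS. Qed.

Lemma fX_lreg : GRing.lreg fX.
Proof. by move=> f g fg; apply: fpsP => n; rewrite -(fpsXMS f) fg fpsXMS. Qed.

Lemma fderiv_is_zmod_morphism : zmod_morphism fderiv.
Proof. by move=> f g; apply: fpsP => n /=; rewrite mulrnBl. Qed.
HB.instance Definition _ :=
  GRing.isZmodMorphism.Build (fps A) (fps A) fderiv fderiv_is_zmod_morphism.

Lemma fderivM f g : fderiv (f * g) = fderiv f * g + f * fderiv g.
Proof.
apply: fX_lreg; rewrite fX_deriv thetaM -!fX_deriv; ring.
Qed.

Lemma fderivC a : fderiv (fconst a) = 0.
Proof. by apply: fX_lreg; rewrite fX_deriv theta_const mulr0. Qed.

Lemma fderivX : fderiv fX = 1.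
Proof. by apply: fpsP => -[|n] //=; rewrite mul0rn. Qed.

(** The substitution [X |-> c X]. *)
Definition dilate c f : fps A := Fps (fun n => c ^+ n * f n).

Lemma dilateE c f n : dilate c f n = c ^+ n * f n. Proof. by []. Qed.

Lemma dilate_is_zmod_morphism c : zmod_morphism (dilate c).
Proof. by move=> f g; apply: fpsP => n /=; rewrite mulrBr. Qed.
HB.instance Definition _ c :=
  GRing.isZmodMorphism.Build (fps A) (fps A) (dilate c) (dilate_is_zmod_morphism c).

Lemma dilate_is_monoid_morphism c : monoid_morphism (dilate c).
Proof.
split; first by apply: fpsP => -[|n] /=; rewrite ?mulr0 ?mulr1.
move=> f g; apply: fpsP => n /=; rewrite mulr_sumr; apply: eq_bigr => i _.
rewrite mulrACA -exprD subnKC //; exact: ltn_ord i.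
Qed.
HB.instance Definition _ c :=
  GRing.isMonoidMorphism.Build (fps A) (fps A) (dilate c) (dilate_is_monoid_morphism c).

Lemma dilate1 c : dilate c 1 = 1. Proof. exact: rmorph1. Qed.
Lemma dilateD c f g : dilate c (f + g) = dilate c f + dilate c g.
Proof. exact: rmorphD. Qed.
Lemma dilateB c f g : dilate c (f - g) = dilate c f - dilate c g.
Proof. exact: rmorphB. Qed.
Lemma dilateM c f g : dilate c (f * g) = dilate c f * dilate c g.
Proof. exact: rmorphM. Qed.

Lemma dilateMn c f n : dilate c (f *+ n) = dilate c f *+ n.
Proof. exact: raddfMn. Qed.

Lemma dilate_dilate c d f : dilate c (dilate d f) = dilate (c * d) f.
Proof. by apply: fpsP => n /=; rewrite exprMn mulrA. Qed.

Lemma fderiv_dilate c f : fderiv (dilate c f) = fconst c * dilate c (fderiv f).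
Proof. by apply: fpsP => n; rewrite fpsCME /= exprS -mulrA !mulrnAr. Qed.

Lemma theta_dilate c f : theta (dilate c f) = dilate c (theta f).
Proof. by apply: fpsP => n /=; rewrite mulrnAr. Qed.

(** The even part of a series, read as a series in [X ^ 2]. *)
Definition evens f : fps A := Fps (fun n => f n.*2).

Lemma evensE f n : evens f n = f n.*2. Proof. by []. Qed.

Definition odd_vanishing f := forall n, f n.*2.+1 = 0.

Lemma sum_double n (h : nat -> A) :
  \sum_(i < n.*2) h i = \sum_(i < n) (h i.*2 + h i.*2.+1).
Proof.
elim: n => [|n IH]; first by rewrite !big_ord0.
by rewrite [RHS]big_ord_recr /= -IH doubleS !big_ord_recr /= addrA.
Qed.

(** An even degree is a sum of two even degrees or of two odd ones. *)
Lemma evensM f g : odd_vanishing g -> evens (f * g) = evens f * evens g.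
Proof.
move=> g0; apply: fpsP => n; rewrite [RHS]/= [LHS]/=.
rewrite big_ord_recr [RHS]big_ord_recr /= !subnn; congr (_ + _).
rewrite (sum_double _ (fun i => f i * g (n.*2 - i)%N)); apply: eq_bigr => i _.
have -> : (n.*2 - i.*2.+1)%N = (n - i).-1.*2.+1 by have := ltn_ord i; lia.
by rewrite g0 mulr0 addr0; congr (_ * g _); lia.
Qed.

End FpsRing.

Arguments fX {A}.
Arguments fpsP {A f g}.

(** * Two systems of linear differential equations *)

Section Increments.
Variable A : comNzRingType.
Implicit Types (P Q : nat -> A) (f : fps A).

(** The series whose coefficients have the partial sums [P]; equivalently
    [(1 - t)] times the generating series of [P]. *)
Definition increments P : fps A :=
  Fps (fun m => if m is m'.+1 then P m - P m' else P 0%N).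

(** [t / (1 - t)], so that multiplying by [tail1] forms the partial sums, shifted
    by one degree. *)
Definition tail1 : fps A := Fps (fun m => (0 < m)%N%:R).

Lemma sum_increments P m : \sum_(j < m.+1) increments P j = P m.
Proof.
elim: m => [|m IH]; first by rewrite big_ord_recl big_ord0 addr0.
by rewrite big_ord_recr IH /= addrC subrK.
Qed.

Lemma tail1M0 f : (tail1 * f) 0%N = 0.
Proof. by rewrite fpsM0E mul0r. Qed.

Lemma tail1MS f m : (tail1 * f) m.+1 = \sum_(j < m.+1) f j.
Proof.
rewrite mulrC fpsME big_ord_recr /= subnn mulr0 addr0; apply: eq_bigr => j _.
by rewrite subn_gt0 ltn_ord mulr1.
Qed.

Lemma theta_increments k P Q : (0 < k)%N ->
    (forall m, (P m.+1 - P m) *+ m.+1 ^ k = Q m) ->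
  iter k (@theta A) (increments P) = tail1 * increments Q.
Proof.
move=> k0 PQ.
have iterE f n : iter k (@theta A) f n = f n *+ n ^ k.
  by elim: k {k0 PQ} => [|k IH] //=; rewrite IH -mulrnA -expnSr.
apply: fpsP => -[|m]; rewrite iterE; first by rewrite exp0n // mulr0n tail1M0.
by rewrite tail1MS sum_increments /= PQ.
Qed.

Lemma incrementsD P Q : increments (fun m => P m + Q m) = increments P + increments Q.
Proof. by apply: fpsP => -[|m]; rewrite fpsDE //= opprD addrACA. Qed.

Lemma incrementsZ a P : increments (fun m => a * P m) = fconst a * increments P.
Proof. by apply: fpsP => -[|m]; rewrite fpsCME //= mulrBr. Qed.

Lemma incrementsMn P : theta (tail1 * increments P) =
  tail1 * increments (fun m => P m *+ m.+1).
Proof.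
apply: fpsP => -[|m]; first by rewrite thetaE !tail1M0 mulr0n.
by rewrite thetaE !tail1MS !sum_increments.
Qed.

End Increments.

Arguments tail1 {A}.

Section Systems.
Variable A : comNzRingType.
Hypothesis torsion_free : forall (a : A) n, a *+ n.+1 = 0 -> a = 0.

Let T := fps A.
Let s : T := tail1.
Local Notation th := (@theta A).

(** The coefficients of degree [m + 1] of the right-hand sides involve only those of
    degree at most [m] of [e] and [y]. *)
Lemma system_unique (z : A) (e y : T) : e 0%N = 0 -> y 0%N = 0 ->
    th (th (th e)) = s * y -> th (th y) = fconst z * th (s * e) ->
  e = 0.
Proof.
move=> e0 y0 He Hy.
have tf a n m p : a *+ n.+1 *+ m.+1 *+ p.+1 = 0 -> a = 0 :> A.
  by do 3! move/torsion_free.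
suff H n : forall j, (j <= n)%N -> e j = 0 /\ y j = 0.
  by apply: fpsP => n; case: (H n n (leqnn n)).
elim: n => [|n IH] j; first by rewrite leqn0 => /eqP ->.
rewrite leq_eqVlt => /orP[/eqP->|]; last by rewrite ltnS; exact: IH.
split.
- have : th (th (th e)) n.+1 = (s * y) n.+1 by rewrite He.
  rewrite !thetaE tail1MS big1 => [|i _]; first exact: tf.
  by have [] := IH i _; rewrite // -ltnS ltn_ord.
- have : th (th y) n.+1 = (fconst z * th (s * e)) n.+1 by rewrite Hy.
  rewrite fpsCME !thetaE tail1MS big1 => [|i _]; last first.
    by have [] := IH i _; rewrite // -ltnS ltn_ord.
  by rewrite mul0rn mulr0; move/torsion_free/torsion_free.
Qed.

(** [F] and [Fb] are the hypergeometric series [2F1(a, -a; 1; t)] for [a ^ 2 = w] and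
    for [a ^ 2 = - w]. *)
Variable w : A.
Let W : T := fconst w.

Variables (F Fb : T).
Hypothesis F0 : F 0%N = 1.
Hypothesis Fb0 : Fb 0%N = 1.
Hypothesis HF : th (th F) = - W * (s * F).
Hypothesis HFb : th (th Fb) = W * (s * Fb).

Let Z : T := fconst (- 4%:R * w ^+ 2).

Let ZE : Z = - 4%:R * W ^+ 2.
Proof. by rewrite /Z rmorphM rmorphXn rmorphN rmorph_nat. Qed.

Let thZ f : th (Z * f) = Z * th f.
Proof. exact: theta_constM. Qed.

Let thW f : th (W * f) = W * th f.
Proof. exact: theta_constM. Qed.

Let th2M (f : T) : th (2%:R * f) = 2%:R * th f.
Proof. by rewrite mulr_natl raddfMn /= mulr_natl. Qed.

Section Order0.
(** [X] and [Y] are the generating functions of the polylogarithms of the words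
    [{3,1}^n] and [1,{3,1}^n], for [x ^ 4 = - 4 w ^ 2]. *)
Variables X Y : T.
Hypothesis X0 : X 0%N = 1.
Hypothesis Y0 : Y 0%N = 0.
Hypothesis HY : th Y = s * X.
Hypothesis HX : th (th (th X)) = fconst (- 4%:R * w ^+ 2) * (s * Y).

Let dF : th (th (F * Fb)) = 2%:R * (th F * th Fb).
Proof. by rewrite !(thetaM, thetaD) HF HFb; ring. Qed.

Let dL : th (th F * Fb - F * th Fb) = - 2%:R * W * (s * (F * Fb)).
Proof. by rewrite !(thetaM, thetaB) /= HF HFb; ring. Qed.

Let dGG : th (th F * th Fb) = W * (s * (th F * Fb - F * th Fb)).
Proof. by rewrite !thetaM /= HF HFb; ring. Qed.

(** In [theta (theta (F * Fb))] the terms with a second derivative cancel, leaving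
    [2 theta F * theta Fb]. Its derivative is [tail1 * U] with
    [U = 2 W (theta F * Fb - F * theta Fb)], where they cancel again in
    [theta U = - 4 W ^ 2 * (tail1 * (F * Fb))]: the pair [(F * Fb, U)] solves the
    same system as [(X, - 4 W ^ 2 * Y)]. *)
Lemma system0_solution : X = F * Fb.
Proof.
apply/eqP; rewrite -subr_eq0; apply/eqP.
apply: (@system_unique (- 4%:R * w ^+ 2) _
  (Z * Y - 2%:R * (W * (th F * Fb - F * th Fb)))).
- by rewrite fpsBE fpsM0E X0 F0 Fb0 mulr1 subrr.
- by rewrite fpsBE !fpsM0E Y0 fpsBE !fpsM0E /= !mulr0n; ring.
- by rewrite !thetaB HX dF th2M dGG -/Z; ring.
rewrite 2!thetaB thZ HY th2M thW dL -/Z.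
have -> : s * (X - F * Fb) = s * X - s * (F * Fb) by ring.
rewrite thetaB mulrBr -!thZ -!thetaB ZE; congr (theta _); ring.
Qed.

Section Order1.
Variables E Eb X1 Y1 : T.
Hypothesis E0 : E 0%N = 0.
Hypothesis Eb0 : Eb 0%N = 0.
Hypothesis HE : th (th E) = - (s * F) - W * (s * E).
Hypothesis HEb : th (th Eb) = - (s * Fb) + W * (s * Eb).
Hypothesis X10 : X1 0%N = 0.
Hypothesis Y10 : Y1 0%N = 0.
Hypothesis HX1 : th (th (th X1)) =
  th (s * X) + fconst (- 4%:R * w ^+ 2) * (s * Y1).
Hypothesis HY1 : th (th Y1) = s * Y + th (s * X1).

(** [X1] is the coefficient of [eps] in [F_(w - eps / 2) F_(- w - eps / 2)], where
    [F_u = 2F1(a, -a; 1; t)] with [a ^ 2 = u]: here [E] and [Eb] are the derivatives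
    of [F_u] with respect to [u] at [w] and at [- w]. The term [theta (s * X)], to
    first order in [eps], is the effect of a letter 2 of weight [eps]. *)
Lemma system1_solution : 2%:R * X1 = - (E * Fb + F * Eb).
Proof.
(* [W * L + th (F * Fb)] is the value that the system imposes on [Z * Y1]. *)
pose L := E * th Fb - th E * Fb + F * th Eb - th F * Eb.
have d2 : th (th (E * Fb + F * Eb)) =
    - 2%:R * (s * X) + 2%:R * (th E * th Fb + th F * th Eb).
  by rewrite system0_solution !(thetaM, thetaD) /= HF HFb HE HEb; ring.
have d3 : th (th (th (E * Fb + F * Eb))) =
    - 2%:R * th (s * X) - 2%:R * (s * (th (F * Fb) + W * L)).
  have -> : - 2%:R * th (s * X) = - th (2%:R * (s * X)) by rewrite th2M; ring.
  rewrite d2 !mulNr thetaD thetaN th2M thetaD !thetaM HF HFb HE HEb /L; ring.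
have dLL : th (W * L) = 2%:R * (W * (W * (s * (E * Fb + F * Eb)))).
  rewrite thW /L !(thetaB, thetaD) !thetaM HF HFb HE HEb; ring.
apply/eqP; rewrite -subr_eq0 opprK; apply/eqP.
apply: (@system_unique (- 4%:R * w ^+ 2) _
  (2%:R * (Z * Y1) - 2%:R * (W * L + th (F * Fb)))).
- by rewrite fpsDE (fpsDE (E * Fb)) !fpsM0E X10 E0 Eb0; ring.
- rewrite fpsBE 2!fpsM0E fpsM0E Y10 (fpsDE (W * L)) fpsM0E /L fpsBE.
  rewrite (fpsDE (_ - _)) fpsBE !fpsM0E E0 Eb0 /=.
  by rewrite !mulr0n; ring.
- rewrite thetaD th2M (thetaD (2%:R * th X1)) th2M thetaD th2M d3 HX1 -/Z; ring.
rewrite -/Z thetaB !th2M (thetaD (W * L)) dLL thZ thetaB !th2M thZ HY1.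
rewrite (thetaD (2%:R * _)) th2M -system0_solution HX -/Z.
have -> : s * (2%:R * X1 + (E * Fb + F * Eb)) =
  2%:R * (s * X1) + s * (E * Fb + F * Eb) by ring.
rewrite thetaD !th2M !thW ZE.
ring.
Qed.

End Order1.
End Order0.
End Systems.

(** * Coefficientwise convergence *)

Section CoefCvg.
Variable R : realType.
Local Open Scope classical_set_scope.
Implicit Types (u v : nat -> fps R) (f g : fps R).

Definition coef_cvg u f := forall k, (fun N => u N k) @ \oo --> f k.

Lemma cvg_sum_ord n (x : nat -> nat -> R) (l : nat -> R) :
    (forall i, (i < n)%N -> (fun N => x N i) @ \oo --> l i) ->
  (fun N => \sum_(i < n) x N i) @ \oo --> \sum_(i < n) l i.
Proof.
elim: n => [|n IH] xl.
  under eq_fun do rewrite big_ord0; rewrite big_ord0; exact: cvg_cst.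
under eq_fun do rewrite big_ord_recr; rewrite big_ord_recr.
by apply: cvgD; [apply: IH => i ni; apply: xl; exact: ltnW|exact: xl].
Qed.

Lemma coef_cvg_cst f : coef_cvg (fun=> f) f.
Proof. by move=> k; exact: cvg_cst. Qed.

Lemma coef_cvgD u v f g : coef_cvg u f -> coef_cvg v g ->
  coef_cvg (fun N => u N + v N) (f + g).
Proof. by move=> uf vg k; apply: cvgD; [exact: uf|exact: vg]. Qed.

Lemma coef_cvgN u f : coef_cvg u f -> coef_cvg (fun N => - u N) (- f).
Proof. by move=> uf k; apply: cvgN; exact: uf. Qed.

Lemma coef_cvgM u v f g : coef_cvg u f -> coef_cvg v g ->
  coef_cvg (fun N => u N * v N) (f * g).
Proof.
move=> uf vg k; apply: (@cvg_sum_ord k.+1 (fun N i => u N i * v N (k - i)%N)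
  (fun i => f i * g (k - i)%N)) => i _.
by apply: cvgM; [exact: uf|exact: vg].
Qed.

Lemma coef_cvg_dilate c u f : coef_cvg u f ->
  coef_cvg (fun N => dilate c (u N)) (dilate c f).
Proof. by move=> uf k; apply: cvgM; [exact: cvg_cst|exact: uf]. Qed.

Lemma coef_cvg_deriv u f : coef_cvg u f ->
  coef_cvg (fun N => fderiv (u N)) (fderiv f).
Proof. by move=> uf k; apply: cvgMn; exact: uf. Qed.

Lemma coef_cvg_evens u f : coef_cvg u f ->
  coef_cvg (fun N => evens (u N)) (evens f).
Proof. by move=> uf k; exact: uf. Qed.

(** Inversion is continuous at series with constant term [1]: the coefficients
    of the quotient are polynomials in those of its two terms. *)
Lemma coef_cvg_div (d q r : nat -> fps R) (D Dinv Q : fps R) :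
    (forall N, d N * q N = r N) -> (forall N, d N 0%N = 1) ->
    coef_cvg d D -> coef_cvg r Q -> Dinv * D = 1 ->
  coef_cvg q (Dinv * Q).
Proof.
move=> dq d0 dD rQ DD.
have D0 : D 0%N = 1.
  rewrite -(cvg_lim (@Rhausdorff R) (dD 0%N)); under eq_fun do rewrite d0.
  by apply: cvg_lim; [exact: Rhausdorff|exact: cvg_cst].
have solve (h x y : fps R) k : h * x = y -> h 0%N = 1 ->
    x k = y k - \sum_(i < k) h i.+1 * x (k - i.+1)%N.
  move=> <- h0; rewrite fpsME big_ord_recl /= h0 mul1r subn0.
  by rewrite addrK.
have DQ : D * (Dinv * Q) = Q by rewrite mulrA [D * _]mulrC DD mul1r.
move=> k; elim/ltn_ind: k => k IH.
rewrite (solve _ _ _ k DQ D0); under eq_fun do rewrite (solve _ _ _ k (dq _) (d0 _)).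
apply: cvgB; first exact: rQ.
apply: (@cvg_sum_ord k (fun N i => d N i.+1 * q N (k - i.+1)%N)
  (fun i => D i.+1 * (Dinv * Q) (k - i.+1)%N)) => i ik.
by apply: cvgM; [exact: dD|apply: IH; lia].
Qed.

End CoefCvg.

(** * Euler's product for the sine *)

Section EulerProduct.
Variable R : realType.
Local Open Scope classical_set_scope.
Implicit Types (c : nat -> R).

(** Its coefficients are the elementary symmetric functions of
    [c 0, ..., c (M - 1)]. *)
Definition eprod c M : fps R := \prod_(j < M) (1 + fconst (c j) * fX).

Lemma eprodS c M : eprod c M.+1 = eprod c M * (1 + fconst (c M) * fX).
Proof. by rewrite /eprod big_ord_recr. Qed.

Lemma eprod0E c M : eprod c M 0%N = 1.
Proof.
elim: M => [|M IH]; first by rewrite /eprod big_ord0.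
by rewrite eprodS fpsM0E IH fpsDE fpsCME /= mulr0 addr0 mulr1.
Qed.

Lemma eprodSS c M k : eprod c M.+1 k.+1 = eprod c M k.+1 + c M * eprod c M k.
Proof.
rewrite eprodS mulrDr mulr1 fpsDE; congr (_ + _).
by rewrite mulrCA fpsCME mulrC [_ * fX]mulrC fpsXMS mulrC.
Qed.

Lemma eprod_ge0 c M k : (forall j, 0 <= c j) -> 0 <= eprod c M k.
Proof.
move=> c0; elim: M k => [|M IH] [|k]; rewrite ?eprod0E //.
  by rewrite /eprod big_ord0.
by rewrite eprodSS addr_ge0 // mulr_ge0.
Qed.

Lemma eprod_le c d M k : (forall j, (j < M)%N -> 0 <= c j <= d j) ->
  0 <= eprod c M k <= eprod d M k.
Proof.
elim: M k => [|M IH] [|k] cd; rewrite ?eprod0E ?ler01 ?lexx //.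
  by rewrite /eprod !big_ord0 /= lexx.
have cd' j : (j < M)%N -> 0 <= c j <= d j by move=> /ltnW jM; exact: cd.
have /andP[cM cdM] := cd M (leqnn _).
have /andP[h1 h2] := IH k.+1 cd'; have /andP[h3 h4] := IH k cd'.
by rewrite !eprodSS addr_ge0 ?mulr_ge0 //= lerD // ler_pM.
Qed.

Lemma eprod_homo c k M N : (forall j, 0 <= c j) -> (M <= N)%N ->
  eprod c M k <= eprod c N k.
Proof.
move=> c0; case: k => [|k]; first by rewrite !eprod0E.
elim: N => [|N IH]; first by rewrite leqn0 => /eqP ->.
rewrite leq_eqVlt => /orP[/eqP -> //|]; rewrite ltnS => /IH /le_trans; apply.
by rewrite eprodSS lerDl mulr_ge0 // eprod_ge0.
Qed.

Lemma eprod_scale a c M : eprod (fun j => a * c j) M = dilate a (eprod c M).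
Proof.
elim: M => [|M IH]; first by rewrite /eprod !big_ord0 dilate1.
rewrite !eprodS IH dilateM dilateD dilate1; congr (_ * (_ + _)).
by apply: fpsP => -[|[|n]]; rewrite dilateE !fpsCME /= ?mulr0 // !mulr1 expr1.
Qed.

Lemma eprod_cvg (c : nat -> nat -> R) (d : nat -> R) M :
    (forall j, (fun N => c N j) @ \oo --> d j) ->
  coef_cvg (fun N => eprod (c N) M) (eprod d M).
Proof.
move=> cd; elim: M => [|M IH] k.
  by rewrite /eprod big_ord0; under eq_fun do rewrite big_ord0; exact: cvg_cst.
case: k => [|k].
  by rewrite eprod0E; under eq_fun do rewrite eprod0E; exact: cvg_cst.
rewrite eprodSS; under eq_fun do rewrite eprodSS.
by apply: cvgD; [exact: IH|apply: cvgM; [exact: cd|exact: IH]].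
Qed.

Lemma coef_prod_poly c M k :
  (\prod_(j < M) (1 + c j *: 'X) : {poly R})`_k = eprod c M k.
Proof.
elim: M k => [|M IH] k.
  by rewrite /eprod !big_ord0 coef1.
rewrite big_ord_recr /= mulrDr mulr1 -scalerAr coefD coefZ coefMX.
case: k => [|k]; first by rewrite mulr0 addr0 IH !eprod0E.
by rewrite eprodSS !IH.
Qed.

(** The polynomials of de Moivre's formula, in the variable [tan x ^ 2]. *)
Definition cos_poly n : {poly R} := \poly_(k < n.+1) ((-1) ^+ k * 'C(n, k.*2)%:R).
Definition sin_poly n : {poly R} := \poly_(k < n.+1) ((-1) ^+ k * 'C(n, k.*2.+1)%:R).

Lemma coef_cos_poly n k : (cos_poly n)`_k = (-1) ^+ k * 'C(n, k.*2)%:R.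
Proof. by rewrite coef_poly; case: ltnP => // nk; rewrite bin_small ?mulr0 //; lia. Qed.

Lemma coef_sin_poly n k : (sin_poly n)`_k = (-1) ^+ k * 'C(n, k.*2.+1)%:R.
Proof. by rewrite coef_poly; case: ltnP => // nk; rewrite bin_small ?mulr0 //; lia. Qed.

Lemma sin_polyS n : sin_poly n.+1 = cos_poly n + sin_poly n.
Proof.
apply/polyP => k; rewrite coefD coef_cos_poly !coef_sin_poly binS natrD; ring.
Qed.

Lemma cos_polyS n : cos_poly n.+1 = cos_poly n - 'X * sin_poly n.
Proof.
apply/polyP => k; rewrite coefB mulrC coefMX !coef_cos_poly.
case: k => [|k]; first by rewrite !bin0 subr0.
by rewrite /= coef_sin_poly doubleS binS natrD exprS; ring.
Qed.

Lemma de_moivre (x : R) n : cos x != 0 ->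
  cos (n%:R * x) = cos x ^+ n * (cos_poly n).[tan x ^+ 2] /\
  sin (n%:R * x) = cos x ^+ n * (tan x * (sin_poly n).[tan x ^+ 2]).
Proof.
move=> cx.
have sx : sin x = tan x * cos x by rewrite /tan mulfVK.
elim: n => [|n [IHc IHs]].
  rewrite mul0r cos0 sin0.
  have -> : cos_poly 0 = 1.
    by apply/polyP => -[|k]; rewrite coef_cos_poly coef1 ?mulr1 // bin_small ?mulr0.
  have -> : sin_poly 0 = 0.
    by apply/polyP => k; rewrite coef_sin_poly coef0 bin_small ?mulr0.
  by rewrite !hornerE.
rewrite -natr1 mulrDl mul1r cosD sinD IHc IHs sx cos_polyS sin_polyS.
by rewrite hornerD hornerN hornerM hornerX hornerD !exprS; split; ring.
Qed.

Lemma sin_bounds (x : R) : 0 < x < pi / 2 -> x * cos x <= sin x <= x.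
Proof.
move=> /andP[x0 xpi].
have [|c] := @MVT R sin cos 0 x x0.
  exact/continuous_subspaceT/continuous_sin.
rewrite in_itv /= sin0 !subr0 => /andP[c0 cx] ->.
have xp : x <= pi by have := pi_gt0 R; lra.
rewrite mulrC ler_pM2r //; apply/andP; split.
  apply: ltW; rewrite ltr_cos ?in_itv //=; apply/andP; split; lra.
by rewrite ler_piMl ?cos_le1 // ltW.
Qed.

Section FixedOrder.
Variable M : nat.
Let n := M.*2.+1.

(** The [M] positive roots of [sin_poly n] are the [tan (node j) ^ 2]. *)
Definition node (j : nat) : R := j.+1%:R * pi / n%:R.

Let n0 : 0 < n%:R :> R. Proof. by rewrite ltr0n. Qed.

Lemma node_itv j : (j < M)%N -> 0 < node j < pi / 2.
Proof.
move=> jM; apply/andP; split; first by rewrite divr_gt0 // mulr_gt0 ?pi_gt0.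
rewrite /node ltr_pdivrMr // mulrAC ltr_pdivlMr // mulrAC mulrC ltr_pM2l ?pi_gt0 //.
by rewrite mulrC -natrM ltr_nat /n; lia.
Qed.

Let cos_node j : (j < M)%N -> 0 < cos (node j).
Proof.
move=> /node_itv /andP[h1 h2]; apply: cos_gt0_pihalf.
by apply/andP; split=> //; have := pi_gt0 R; lra.
Qed.

Let sin_node j : (j < M)%N -> 0 < sin (node j).
Proof. by move=> /node_itv; exact: sin_gt0_pihalf. Qed.

Let tan_node j : (j < M)%N -> 0 < tan (node j).
Proof. by move=> jM; rewrite divr_gt0 ?cos_node ?sin_node. Qed.

Let root_node j : (j < M)%N -> root (sin_poly n) (tan (node j) ^+ 2).
Proof.
move=> jM; have [_] := @de_moivre (node j) n (lt0r_neq0 (cos_node jM)).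
have -> : n%:R * node j = j.+1%:R * pi.
  by rewrite /node mulrC divfK // lt0r_neq0.
have -> : sin (j.+1%:R * pi : R) = 0.
  elim: (j.+1) => [|k IH]; first by rewrite mul0r sin0.
  by rewrite -natr1 mulrDl mul1r sinD IH sinpi mul0r mulr0 addr0.
move/esym/eqP; rewrite mulf_eq0 expf_eq0 (gt_eqF (cos_node jM)) andbF /=.
by rewrite mulf_eq0 (gt_eqF (tan_node jM)).
Qed.

Let ts := [seq tan (node j) ^+ 2 | j <- iota 0 M].

Let uniq_ts : uniq ts.
Proof.
rewrite map_inj_in_uniq ?iota_uniq // => i j.
rewrite !mem_iota !add0n /= => iM jM.
have ti := tan_node iM; have tj := tan_node jM.
move/eqP; rewrite eqrXn2 ?ltW // => /eqP.
have dom k : (k < M)%N -> node k \in `](- (pi / 2)), (pi / 2)[%R.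
  move=> /node_itv /andP[h1 h2]; rewrite in_itv /= h2 andbT.
  by have := pi_gt0 R; lra.
move/(tan_inj (dom _ iM) (dom _ jM))/eqP.
rewrite /node eqr_div ?lt0r_neq0 // -!mulrA (inj_eq (mulIf _)).
  by rewrite eqr_nat eqSS => /eqP.
by rewrite mulf_neq0 ?lt0r_neq0 // pi_gt0.
Qed.

Let size_sin_poly : size (sin_poly n) = (size ts).+1.
Proof.
rewrite size_map size_iota; apply/eqP; rewrite eqn_leq; apply/andP; split.
  apply/leq_sizeP => k Mk; rewrite coef_sin_poly bin_small ?mulr0 // /n; lia.
rewrite ltnNge; apply/negP => /leq_sizeP /(_ M (leqnn _)) /eqP.
by rewrite coef_sin_poly -/n binn mulr1 signr_eq0.
Qed.

(** [sin_poly n] vanishes at the [tan (node j) ^ 2], since [sin (n * node j) = 0];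
    its degree is [M], so that these are its roots. Comparing coefficients evaluates
    the elementary symmetric functions of the [cot (node j) ^ 2 / n ^ 2]. *)
Lemma sin_poly_factor k :
  'C(n, k.*2.+1)%:R / n%:R ^+ k.*2.+1 =
  eprod (fun j => (n%:R * tan (node j)) ^- 2) M k.
Proof.
have tn0 j : (j < M)%N -> tan (node j) ^+ 2 != 0.
  by move=> jM; rewrite expf_neq0 // lt0r_neq0 // tan_node.
have Hp := all_roots_prod_XsubC size_sin_poly.
rewrite uniq_rootsE in Hp.
have {}Hp := Hp _ uniq_ts.
have : all (root (sin_poly n)) ts.
  apply/allP => _ /mapP[j + ->]; rewrite mem_iota add0n /= => jM; exact: root_node.
move=> /Hp {}Hp.
pose c j : R := - tan (node j) ^- 2.
have [a Ha] : exists a, sin_poly n = a *: \prod_(j < M) (1 + c j *: 'X).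
  exists (lead_coef (sin_poly n) * \prod_(j < M) (- tan (node j) ^+ 2)).
  rewrite {1}Hp -scalerA; congr (_ *: _).
  rewrite /ts big_map -{1}(subn0 M) big_mkord -scaler_prod; apply: eq_bigr => j _.
  rewrite scalerDr scalerA /c mulrNN mulfV ?tn0 // scale1r addrC; congr (_ + _).
  by rewrite scaleNr -alg_polyC.
have an : a = n%:R.
  have := congr1 (fun p : {poly R} => p`_0) Ha.
  by rewrite coef_sin_poly coefZ coef_prod_poly eprod0E bin1 expr0 mul1r mulr1.
have := congr1 (fun p : {poly R} => p`_k) Ha.
rewrite coef_sin_poly coefZ coef_prod_poly an.
have -> : eprod c M = dilate (-1) (eprod (fun j => tan (node j) ^- 2) M).
  by rewrite -eprod_scale; congr eprod; apply/funext => j; rewrite mulN1r.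
rewrite /= mulrCA => /(mulfI _) -> //; last by rewrite signr_eq0.
have -> : (fun j => (n%:R * tan (node j)) ^- 2) =
    (fun j => n%:R ^- 2 * tan (node j) ^- 2).
  by apply/funext => j; rewrite exprMn invfM.
rewrite eprod_scale /= exprS invfM mulrA [n%:R * _]mulrC mulfK ?lt0r_neq0 //.
by rewrite mulrC -exprVn -exprM -muln2 mulnC exprVn.
Qed.

Lemma tan_node_bounds j : (j < M)%N ->
  (cos (node j) / (j.+1%:R * pi)) ^+ 2 <= (n%:R * tan (node j)) ^- 2
    <= (j.+1%:R * pi) ^- 2.
Proof.
move=> jM; have := sin_bounds (node_itv jM) => /andP[h1 h2].
have j0 : 0 < j.+1%:R * pi :> R by rewrite mulr_gt0 ?pi_gt0.
have jE : j.+1%:R * pi = n%:R * node j.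
  by rewrite /node [RHS]mulrC divfK // lt0r_neq0.
have x0 := node_itv jM; have /andP[{}x0 _] := x0.
have nx : 0 < n%:R * node j by rewrite mulr_gt0.
have nt : 0 < n%:R * tan (node j) by rewrite mulr_gt0 ?tan_node.
have cx := cos_node jM; have sx := sin_node jM.
rewrite -!exprVn jE; apply/andP; split.
  apply: lerXn2r; rewrite ?nnegrE.
  - by apply/ltW; rewrite divr_gt0.
  - by rewrite invr_ge0 ltW.
  rewrite /tan mulrA invf_div ler_pM2l ?cos_node //.
  by rewrite lef_pV2 ?posrE ?ler_pM2l // mulr_gt0 ?sin_node.
apply: lerXn2r; rewrite ?nnegrE; [by rewrite invr_ge0 ltW|by rewrite invr_ge0 ltW|].
rewrite lef_pV2 ?posrE // ler_pM2l // /tan ler_pdivlMr ?cos_node //.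
Qed.

End FixedOrder.

Lemma cvg_nat_ratio (a : R) : (fun M => a / M.*2.+1%:R) @ \oo --> (0 : R).
Proof.
rewrite -[X in _ --> X](mulr0 a); apply: cvgM; first exact: cvg_cst.
apply: (@squeeze_cvgr _ _ _ _ (cst 0) (@harmonic R)).
- near=> m; rewrite invr_ge0 ler0n /= /harmonic lef_pV2 ?posrE // ler_nat; lia.
- exact: cvg_cst.
- exact: cvg_harmonic.
Unshelve. all: by end_near. Qed.

Lemma bin_ratio_cvg m :
  (fun M => 'C(M.*2.+1, m)%:R / M.*2.+1%:R ^+ m) @ \oo --> (m`!%:R^-1 : R).
Proof.
have -> : (fun M => 'C(M.*2.+1, m)%:R / M.*2.+1%:R ^+ m) =
    (fun M => m`!%:R^-1 * \prod_(i < m) ((M.*2.+1 - i)%:R / M.*2.+1%:R)) :> (nat -> R).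
  apply/funext => M; rewrite prodf_div prodr_const card_ord -natr_prod.
  rewrite -ffact_prod -bin_ffact natrM mulrA; congr (_ / _).
  by rewrite mulrC mulfK // pnatr_eq0 -lt0n fact_gt0.
rewrite -[X in _ --> X]mulr1; apply: cvgM; first exact: cvg_cst.
elim: m => [|m IH].
  under eq_fun do rewrite big_ord0; exact: cvg_cst.
have -> : (fun M => \prod_(i < m.+1) ((M.*2.+1 - i)%:R / M.*2.+1%:R)) =
    (fun M => \prod_(i < m) ((M.*2.+1 - i)%:R / M.*2.+1%:R) *
      ((M.*2.+1 - m)%:R / M.*2.+1%:R)) :> (nat -> R).
  by apply/funext => M; rewrite big_ord_recr.
rewrite -[X in _ --> X]mulr1; apply: cvgM => //.
rewrite -[X in _ --> X](subr0 1).
have lim0 : (fun M => 1 - m%:R / M.*2.+1%:R) @ \oo --> (1 - 0 : R).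
  by apply: cvgB; [exact: cvg_cst|exact: cvg_nat_ratio].
apply: cvg_trans lim0; apply: near_eq_cvg; near=> M.
have mM : (m <= M.*2.+1)%N.
  have : (m <= M)%N by near: M; exact: nbhs_infty_ge.
  lia.
by rewrite natrB // mulrBl divff // pnatr_eq0.
Unshelve. all: by end_near. Qed.

(** For fixed [M], the first [M] of the numbers [cot (node j) ^ 2 / n ^ 2] tend to
    the [((j + 1) pi) ^ -2] when [n] grows; the remaining ones are nonnegative and
    only increase the symmetric functions. *)
Lemma eprod_pi_le M k :
  eprod (fun j => (j.+1%:R * pi) ^- 2) M k <= k.*2.+1`!%:R^-1.
Proof.
pose c N j : R := (cos (node N j) / (j.+1%:R * pi)) ^+ 2.
have cvg_c : (fun N => eprod (c N) M k) @ \oo -->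
    eprod (fun j => (j.+1%:R * pi) ^- 2) M k.
  apply: eprod_cvg => j; rewrite /c.
  have -> : ((j.+1%:R * pi) ^- 2 : R) = (cos 0 / (j.+1%:R * pi)) ^+ 2.
    by rewrite cos0 div1r exprVn.
  under eq_fun do rewrite expr2; rewrite expr2.
  suff h : (fun N => cos (node N j) / (j.+1%:R * pi)) @ \oo -->
      (cos 0 / (j.+1%:R * pi) : R).
    exact: cvgM.
  apply: cvgM; last exact: cvg_cst.
  apply: continuous_cvg; first exact: continuous_cos.
  exact: cvg_nat_ratio.
apply: (ler_cvg_to cvg_c (@bin_ratio_cvg k.*2.+1)).
near=> N.
have MN : (M <= N)%N by near: N; exact: nbhs_infty_ge.
rewrite sin_poly_factor.
have c0 j : 0 <= (N.*2.+1%:R * tan (node N j)) ^- 2 :> R by rewrite invr_ge0 sqr_ge0.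
apply: le_trans (eprod_homo k c0 MN).
have cle j : (j < M)%N -> 0 <= c N j <= (N.*2.+1%:R * tan (node N j)) ^- 2.
  by move=> jM; rewrite sqr_ge0; case/andP: (tan_node_bounds (leq_trans jM MN)).
by case/andP: (eprod_le k cle).
Unshelve. all: by end_near. Qed.

(** As [cot y < 1 / y], the symmetric functions of the
    [cot (node j) ^ 2 / n ^ 2] bound those of the [((j + 1) pi) ^ -2] from below. *)
Lemma eprod_pi_cvg k :
  (fun M => eprod (fun j => (j.+1%:R * pi) ^- 2) M k) @ \oo --> (k.*2.+1`!%:R^-1 : R).
Proof.
apply: (@squeeze_cvgr _ _ _ _
    (fun N => 'C(N.*2.+1, k.*2.+1)%:R / N.*2.+1%:R ^+ k.*2.+1) (cst (k.*2.+1`!%:R^-1))).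
- near=> M; rewrite eprod_pi_le andbT sin_poly_factor.
  have cle j : (j < M)%N ->
      0 <= (M.*2.+1%:R * tan (node M j)) ^- 2 <= (j.+1%:R * pi : R) ^- 2.
    by move=> jM; rewrite invr_ge0 sqr_ge0; case/andP: (tan_node_bounds jM).
  by case/andP: (eprod_le k cle).
- exact: bin_ratio_cvg.
- exact: cvg_cst.
Unshelve. all: by end_near. Qed.

(** [sinh (X ^ 1/2) / X ^ 1/2]. *)
Definition sinhc : fps R := Fps (fun k => k.*2.+1`!%:R^-1).

(** For [a = -1] this is [sin (pi y) = pi y * prod_j (1 - y ^ 2 / j ^ 2)], with
    [X = y ^ 2]. *)
Lemma euler_product a :
  coef_cvg (eprod (fun j => a * j.+1%:R ^- 2)) (dilate (a * pi ^+ 2) sinhc).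
Proof.
have -> : eprod (fun j => a * j.+1%:R ^- 2) =
    (fun M => dilate (a * pi ^+ 2) (eprod (fun j => (j.+1%:R * pi) ^- 2) M)).
  apply/funext => M; rewrite -eprod_scale; congr eprod; apply/funext => j.
  by rewrite exprMn (invfM (_ ^+ 2)) mulrACA divff ?mulr1 // expf_neq0 // gt_eqF // pi_gt0.
apply: coef_cvg_dilate; exact: eprod_pi_cvg.
Qed.

Lemma euler_sin :
  coef_cvg (eprod (fun j => - j.+1%:R ^- 2)) (dilate (- pi ^+ 2) sinhc).
Proof.
have := @euler_product (-1); rewrite mulN1r.
by under eq_fun do rewrite mulN1r.
Qed.

Lemma euler_sinh :
  coef_cvg (eprod (fun j => j.+1%:R ^- 2)) (dilate (pi ^+ 2) sinhc).
Proof.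
have := @euler_product 1; rewrite mul1r.
by under eq_fun do rewrite mul1r.
Qed.

End EulerProduct.

(** * Products of hyperbolic and circular series *)

Section TrigSeries.
Variable R : realType.
Local Notation sh := (sinhc R).

(** [cosh (X ^ 1/2)]. *)
Definition coshc : fps R := Fps (fun k => k.*2`!%:R^-1).

(** [sin (X ^ 1/2) / X ^ 1/2] and [cos (X ^ 1/2)]. *)
Definition sinc : fps R := dilate (-1) sh.
Definition cosc : fps R := dilate (-1) coshc.

Let fact_neq0 n : n`!%:R != 0 :> R.
Proof. by rewrite pnatr_eq0 -lt0n fact_gt0. Qed.

Lemma theta_sinhc : theta sh *+ 2 = coshc - sh.
Proof.
apply: fpsP => k; rewrite fpsMnE fpsBE thetaE /= factS natrM -mulrnA.
rewrite -[LHS]mulr_natr muln2.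
have -> : k.*2%:R = k.*2.+1%:R - 1 :> R by rewrite -natr1 addrK.
have : k.*2.+1%:R != 0 :> R by rewrite pnatr_eq0.
by move: (k.*2.+1%:R) => d d0; field; rewrite d0 fact_neq0.
Qed.

Lemma theta_coshc : theta coshc *+ 2 = fX * sh.
Proof.
apply: fpsP => -[|k]; first by rewrite fpsMnE fpsXM0 thetaE mulr0n mul0rn.
rewrite fpsMnE fpsXMS thetaE /= doubleS factS natrM -mulrnA.
by rewrite -[LHS]mulr_natr muln2 doubleS invfM mulrAC mulVf ?mul1r // pnatr_eq0.
Qed.

Lemma theta_sinc : theta sinc *+ 2 = cosc - sinc.
Proof. by rewrite theta_dilate -dilateMn theta_sinhc dilateB. Qed.

Lemma dilateX (c : R) : dilate c fX = fconst c * fX.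
Proof.
by apply: fpsP => -[|[|k]]; rewrite dilateE fpsCME /= ?expr1 // !mulr0.
Qed.

Lemma theta_cosc : theta cosc *+ 2 = - (fX * sinc).
Proof.
by rewrite theta_dilate -dilateMn theta_coshc dilateM dilateX rmorphN1 mulN1r mulNr.
Qed.

(** With [s = sinh * sin], the four series [s], [s'], [s''] and [s'''] are, up to
    constants and powers of the variable, [sh * sinc] and the three below; the
    equations between them amount to [s'''' = - 4 s]. *)
Definition wr0 := sh * sinc.
Definition wr1 := sh * cosc + coshc * sinc.
Definition wr2 := coshc * cosc.
Definition wr3 := sh * cosc - coshc * sinc.

Let dsh : 2%:R * theta sh = coshc - sh.
Proof. by rewrite mulr_natl theta_sinhc. Qed.
Let dch : 2%:R * theta coshc = fX * sh.
Proof. by rewrite mulr_natl theta_coshc. Qed.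
Let dsn : 2%:R * theta sinc = cosc - sinc.
Proof. by rewrite mulr_natl theta_sinc. Qed.
Let dcn : 2%:R * theta cosc = - (fX * sinc).
Proof. by rewrite mulr_natl theta_cosc. Qed.

Lemma theta_wr0 : theta wr0 *+ 2 = wr1 - wr0 *+ 2.
Proof.
transitivity (sinc * (2%:R * theta sh) + sh * (2%:R * theta sinc)).
  by rewrite /wr0 thetaM -mulr_natl; ring.
by rewrite dsh dsn /wr1 /wr0; ring.
Qed.

Lemma theta_wr1 : theta wr1 *+ 2 = wr2 *+ 2 - wr1.
Proof.
transitivity (cosc * (2%:R * theta sh) + sh * (2%:R * theta cosc)
  + (sinc * (2%:R * theta coshc) + coshc * (2%:R * theta sinc))).
  by rewrite /wr1 thetaD !thetaM -mulr_natl; ring.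
by rewrite dsh dsn dch dcn /wr1 /wr2; ring.
Qed.

Lemma theta_wr2 : theta wr2 *+ 2 = fX * wr3.
Proof.
transitivity (cosc * (2%:R * theta coshc) + coshc * (2%:R * theta cosc)).
  by rewrite /wr2 thetaM -mulr_natl; ring.
by rewrite dch dcn /wr3; ring.
Qed.

Lemma theta_wr3 : theta wr3 *+ 2 = - (fX * wr0) *+ 2 - wr3.
Proof.
transitivity (cosc * (2%:R * theta sh) + sh * (2%:R * theta cosc)
  - (sinc * (2%:R * theta coshc) + coshc * (2%:R * theta sinc))).
  by rewrite /wr3 thetaB !thetaM -mulr_natl; ring.
by rewrite dsh dsn dch dcn /wr0 /wr3; ring.
Qed.

Lemma wronskian_sinc : (sinc * theta sh - theta sinc * sh) *+ 2 = - wr3.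
Proof.
transitivity (sinc * (2%:R * theta sh) - sh * (2%:R * theta sinc)).
  by rewrite -mulr_natl; ring.
by rewrite dsh dsn /wr3; ring.
Qed.

Lemma wr_rec m : [/\ wr0 m * (2 * m + 2)%:R = wr1 m,
  wr1 m * (2 * m + 1)%:R = wr2 m * 2, wr2 m.+1 * (2 * m + 2)%:R = wr3 m &
  wr3 m.+1 * (2 * m + 3)%:R = - (wr0 m * 2)].
Proof.
split.
- have : (theta wr0 *+ 2) m = (wr1 - wr0 *+ 2) m by rewrite theta_wr0.
  rewrite fpsMnE fpsBE fpsMnE thetaE -mulrnA => h.
  by rewrite natrD mulrDr !mulr_natr [(2 * m)%N]mulnC h subrK.
- have : (theta wr1 *+ 2) m = (wr2 *+ 2 - wr1) m by rewrite theta_wr1.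
  rewrite fpsMnE fpsBE fpsMnE thetaE -mulrnA => h.
  by rewrite natrD mulrDr !mulr_natr [(2 * m)%N]mulnC h subrK.
- have : (theta wr2 *+ 2) m.+1 = (fX * wr3) m.+1 by rewrite theta_wr2.
  rewrite fpsMnE fpsXMS thetaE -mulrnA => <-.
  by rewrite mulr_natr; congr (_ *+ _); lia.
have : (theta wr3 *+ 2) m.+1 = (- (fX * wr0) *+ 2 - wr3) m.+1 by rewrite theta_wr3.
rewrite fpsMnE fpsBE fpsMnE fpsNE fpsXMS thetaE -mulrnA => h.
have -> : (2 * m + 3 = m.+1 * 2 + 1)%N by lia.
by rewrite natrD mulrDr !mulr_natr h mulr1n subrK mulNrn.
Qed.

(** Four steps of the recurrence multiply the coefficient by
    [-4 / ((4n + 3) (4n + 4) (4n + 5) (4n + 6))]. *)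
Lemma wr0_even n : wr0 n.*2 = 2 * (-4) ^+ n / (4 * n + 2)`!%:R.
Proof.
elim: n => [|n IH].
  have s0 : sh 0%N = 1 by rewrite /= invr1.
  rewrite -[0.*2]/0%N /wr0 fpsM0E /sinc dilateE s0 !mulr1.
  have -> : (4 * 0 + 2)`! = 2%N by [].
  by rewrite divff // pnatr_eq0.
have [_ _ _ h3] := wr_rec n.*2.
have [_ _ h2 _] := wr_rec n.*2.+1.
have [h0 h1 _ _] := wr_rec n.*2.+2.
have -> : (4 * n.+1 + 2 = (4 * n + 2).+4)%N by lia.
have nz k : (2 * k + 1)%:R != 0 :> R by rewrite pnatr_eq0 addn1.
have nz2 k : (2 * k + 2)%:R != 0 :> R by rewrite pnatr_eq0 addn2.
have nz3 k : (2 * k + 3)%:R != 0 :> R by rewrite pnatr_eq0 addn3.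
rewrite doubleS; apply: (mulIf (nz2 n.*2.+2)); rewrite h0.
apply: (mulIf (nz n.*2.+2)); rewrite h1.
apply: (mulIf (nz2 n.*2.+1)); rewrite mulrAC h2.
apply: (mulIf (nz3 n.*2)); rewrite mulrAC h3 IH.
rewrite !factS !natrM exprS.
have -> : (2 * n.*2.+2 + 2 = (4 * n + 2).+4)%N by lia.
have -> : (2 * n.*2.+2 + 1 = (4 * n + 2).+3)%N by lia.
have -> : (2 * n.*2.+1 + 2 = (4 * n + 2).+2)%N by lia.
have -> : (2 * n.*2 + 3 = (4 * n + 2).+1)%N by lia.
have d0 k : k.+1%:R != 0 :> R by rewrite pnatr_eq0.
move: (d0 (4 * n + 2)%N) (d0 (4 * n + 2).+1) (d0 (4 * n + 2).+2) (d0 (4 * n + 2).+3).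
move: _.+1%:R _.+2%:R _.+3%:R _.+4%:R => d1 d2 d3 d4 n1 n2 n3 n4.
by field; rewrite fact_neq0 n1 n2 n3 n4.
Qed.

Lemma wr3_odd n : wr3 n.*2.+1 = (-4) ^+ n.+1 / (4 * n + 3)`!%:R.
Proof.
have [_ _ _ h3] := wr_rec n.*2.
have nz3 k : (2 * k + 3)%:R != 0 :> R by rewrite pnatr_eq0 addn3.
apply: (mulIf (nz3 n.*2)); rewrite h3 wr0_even.
have -> : (2 * n.*2 + 3 = 4 * n + 3)%N by lia.
have -> : (4 * n + 3 = (4 * n + 2).+1)%N by lia.
rewrite factS natrM exprS.
have : (4 * n + 2).+1%:R != 0 :> R by rewrite pnatr_eq0.
by move: ((4 * n + 2).+1%:R) => d d0; field; rewrite d0 fact_neq0.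
Qed.

(** The product is invariant under [X |-> - X]. *)
Lemma odd_vanishing_symm (f : fps R) : odd_vanishing (f * dilate (-1) f).
Proof.
move=> n; set g := f * _.
have : dilate (-1) g = g.
  rewrite dilateM dilate_dilate mulrNN mulr1 mulrC; congr (_ * _).
  by apply: fpsP => k; rewrite dilateE expr1n mul1r.
move/(congr1 (fun h : fps R => h n.*2.+1)); rewrite dilateE -signr_odd /= odd_double.
by rewrite mulN1r => /eqP; rewrite -subr_eq0 -opprD oppr_eq0 -mulr2n mulrn_eq0 => /eqP.
Qed.

End TrigSeries.

(** * Bernoulli numbers as formal series *)

Section BernoulliSeries.
Variable R : realType.
Local Notation sh := (sinhc R).
Variable B : nat -> R.

Definition exp_series : fps R := Fps (fun n => n`!%:R^-1).
Definition bern_series : fps R := Fps (fun n => B n / n`!%:R).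
Local Notation e := exp_series.
Local Notation em := (dilate (-1) exp_series).
Local Notation b := bern_series.
Local Notation b2 := (dilate 2 bern_series).

Hypothesis bE : b * (e - 1) = fX.

Let fact_neq0 n : n`!%:R != 0 :> R.
Proof. by rewrite pnatr_eq0 -lt0n fact_gt0. Qed.

Let de : fderiv e = e.
Proof.
apply: fpsP => n /=; rewrite factS natrM -mulr_natr.
by field; rewrite fact_neq0 addrC natr1 pnatr_eq0.
Qed.

Lemma fderiv_eq0 (f : fps R) : fderiv f = 0 -> f = fconst (f 0%N).
Proof.
move=> f0; apply: fpsP => -[|n] //=.
have /eqP : fderiv f n = 0 by rewrite f0.
by rewrite /= mulrn_eq0 => /eqP.
Qed.

Let dem : fderiv em = - em.
Proof. by rewrite fderiv_dilate de rmorphN1 mulN1r. Qed.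

Let e_em : e * em = 1.
Proof.
have -> : e * em = fconst ((e * em) 0%N).
  by apply: fderiv_eq0; rewrite fderivM de dem mulrN subrr.
by rewrite fpsM0E dilateE /= fact0 invr1 !mulr1 rmorph1.
Qed.

Let dil_e : dilate 2 e = e * e.
Proof.
have h : dilate 2 e * (em * em) = 1.
  have -> : dilate 2 e * (em * em) = fconst ((dilate 2 e * (em * em)) 0%N).
    apply: fderiv_eq0; rewrite !fderivM fderiv_dilate de dem rmorph_nat; ring.
  by rewrite !fpsM0E !dilateE /= fact0 invr1 !mulr1 rmorph1.
transitivity (dilate 2 e * (em * em) * (e * e)); last by rewrite h mul1r.
transitivity (dilate 2 e * ((e * em) * (e * em))); first by rewrite e_em !mulr1.
ring.
Qed.

Let b2E : b2 * (e * e - 1) = 2%:R * fX.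
Proof.
have -> : e * e - 1 = dilate 2 (e - 1) by rewrite dilateB dilate1 dil_e.
by rewrite -dilateM bE dilateX rmorph_nat.
Qed.

(** [sinh X / X] and [cosh X]. *)
Let she : fps R := Fps (fun n => if odd n then 0 else n.+1`!%:R^-1).
Let che : fps R := Fps (fun n => if odd n then 0 else n`!%:R^-1).

Let e_sub : e - em = 2%:R * (fX * she).
Proof.
apply: fpsP => n; rewrite mulr_natl fpsMnE fpsBE dilateE -signr_odd.
case: n => [|n]; first by rewrite fpsXM0 mul0rn expr0 mul1r subrr.
rewrite fpsXMS /=; case: (odd n); first by rewrite mul1r subrr mul0rn.
by rewrite mulN1r opprK mulr2n.
Qed.

Let e_add : e + em = 2%:R * che.
Proof.
apply: fpsP => n; rewrite mulr_natl fpsMnE fpsDE dilateE -signr_odd /=.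
case: (odd n); first by rewrite mulN1r subrr mul0rn.
by rewrite mul1r mulr2n.
Qed.

Let two_inj (f g : fps R) : 2%:R * f = 2%:R * g -> f = g.
Proof.
move=> fg; apply: fpsP => n.
have : (f *+ 2) n = (g *+ 2) n by rewrite -(mulr_natl f) fg mulr_natl.
rewrite !fpsMnE => /eqP; by rewrite -subr_eq0 -mulrnBl mulrn_eq0 subr_eq0 => /eqP.
Qed.

Let she_odd : odd_vanishing she.
Proof. by move=> n /=; rewrite odd_double. Qed.

(** [X / sinh X = 2 b(X) - b(2 X)]. *)
Definition csch_series : fps R := evens (2%:R * b - b2).

Lemma csch_seriesE k :
  csch_series k = (2 - 2 ^+ (2 * k)) * B (2 * k)%N / (2 * k)`!%:R.
Proof.
rewrite /csch_series evensE fpsBE mulr_natl fpsMnE dilateE /= -mul2n.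
by rewrite -[X in X - _]mulr_natl -!mulrA mulrBl.
Qed.

(** [b(2 X) (e ^ 2X - 1) = 2 X] and [2 b(X) (e ^ 2X - 1) = 2 X (e ^ X + 1)], whose
    difference is [2 X e ^ X]. *)
Lemma csch_sinhc : csch_series * sh = 1.
Proof.
have -> : sh = evens she by apply: fpsP => n; rewrite /= odd_double.
rewrite -evensM //.
suff -> : (2%:R * b - b2) * she = 1 by apply: fpsP => -[|n].
apply: fX_lreg; apply: two_inj; rewrite mulr1.
have -> : 2%:R * (fX * ((2%:R * b - b2) * she)) = (2%:R * b - b2) * (e - em).
  by rewrite e_sub; ring.
have -> : e - em = em * (e * e - 1) by rewrite mulrBr mulr1 mulrCA mulrA e_em mul1r.
have -> : (2%:R * b - b2) * (em * (e * e - 1)) =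
    em * (2%:R * (b * (e - 1)) * (e + 1) - b2 * (e * e - 1)) by ring.
rewrite bE b2E; transitivity (2%:R * fX * (e * em)); first ring.
by rewrite e_em mulr1.
Qed.

(** [2 X / (e ^ 2X - 1) + X = X cosh X / sinh X]. *)
Definition coth_series : fps R := evens b2.

Lemma coth_seriesE k : coth_series k = 2 ^+ (2 * k) * B (2 * k)%N / (2 * k)`!%:R.
Proof. by rewrite /coth_series /= -mul2n mulrA. Qed.

Lemma coth_sinhc : coth_series * sh = coshc R.
Proof.
have -> : coshc R = evens che by apply: fpsP => n; rewrite /= odd_double.
have -> : sh = evens she by apply: fpsP => n; rewrite /= odd_double.
have -> : coth_series = evens (b2 + fX).
  apply: fpsP => n; rewrite /coth_series !evensE fpsDE.
  by case: n => [|n]; rewrite ?addr0.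
rewrite -evensM //; congr evens.
apply: fX_lreg; apply: two_inj.
have -> : 2%:R * (fX * ((b2 + fX) * she)) = (b2 + fX) * (e - em).
  by rewrite e_sub; ring.
have -> : 2%:R * (fX * che) = fX * (e + em) by rewrite e_add; ring.
have -> : (b2 + fX) * (e - em) = b2 * (e - em) + fX * (e - em) by ring.
have -> : e - em = em * (e * e - 1) by rewrite mulrBr mulr1 mulrCA mulrA e_em mul1r.
transitivity (em * (b2 * (e * e - 1)) + fX * ((e * em) * e - em)); first ring.
by rewrite b2E e_em; ring.
Qed.

End BernoulliSeries.

(** * Products and uniqueness of convergent series *)

Section SeriesProduct.
Variable R : realType.
Local Open Scope classical_set_scope.
Implicit Types f g : fps R.

Lemma sum_fmul f g N :
  \sum_(n < N) (f * g) n = \sum_(i < N) f i * \sum_(j < N - i) g j.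
Proof.
elim: N => [|N IH]; first by rewrite !big_ord0.
rewrite big_ord_recr /= IH [RHS]big_ord_recr /= subSn // subnn big_ord1.
rewrite big_ord_recr /= subnn addrA -big_split /=; congr (_ + _).
apply: eq_bigr => i _; rewrite -mulrDr; congr (_ * _).
by rewrite subSn ?big_ord_recr // ltnW.
Qed.

Lemma series_ordE (u : nat -> R) N : series u N = \sum_(i < N) u i.
Proof. by rewrite seriesEord. Qed.

Lemma series_nneg_homo (u : nat -> R) : (forall n, 0 <= u n) ->
  {homo series u : M N / (M <= N)%N >-> M <= N}.
Proof.
move=> u0; apply/nondecreasing_seqP => n.
by rewrite !series_ordE big_ord_recr /= lerDl.
Qed.

(** For nonnegative terms the [N]th partial sum of the product lies between the
    products of the [(N / 2)]th and of the [N]th partial sums. *)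
Lemma cvg_fmul_nneg f g (a b : R) :
    (forall n, 0 <= f n) -> (forall n, 0 <= g n) ->
    series f @ \oo --> a -> series g @ \oo --> b ->
  series (f * g) @ \oo --> a * b.
Proof.
move=> f0 g0 fa gb.
have half (u : nat -> R) l : u @ \oo --> l -> (fun N => u N./2) @ \oo --> l.
  move=> ul; apply: cvg_comp ul => A [N _ NA].
  by exists N.*2 => // n /= Nn; apply: NA => /=; lia.
apply: (@squeeze_cvgr _ _ _ _
    (fun N => series f N./2 * series g N./2) (fun N => series f N * series g N)).
- near=> N; rewrite !series_ordE sum_fmul; apply/andP; split.
    rewrite big_distrl /=.
    have -> : \sum_(i < N) f i * (\sum_(j < N - i) g j) =
        \sum_(i < N./2) f i * (\sum_(j < N - i) g j) +
        \sum_(N./2 <= i < N) f i * (\sum_(j < N - i) g j).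
      rewrite -(big_mkord xpredT (fun i => f i * (\sum_(j < N - i) g j))).
      rewrite -(big_mkord xpredT (fun i => f i * (\sum_(j < N - i) g j))).
      by rewrite -big_cat_nat //; lia.
    rewrite -[leLHS]addr0 lerD //; last first.
      by apply: sumr_ge0 => i _; rewrite mulr_ge0 // sumr_ge0.
    apply: ler_sum => i _; rewrite ler_wpM2l // -!series_ordE series_nneg_homo //.
    by have := ltn_ord i; lia.
  rewrite big_distrl /=; apply: ler_sum => i _; rewrite ler_wpM2l //.
  by rewrite -!series_ordE series_nneg_homo // leq_subr.
- by apply: cvgM; apply: half.
- exact: cvgM.
Unshelve. all: by end_near. Qed.

Lemma series_fpsB f g (a b : R) : series f @ \oo --> a -> series g @ \oo --> b ->
  series (f - g) @ \oo --> a - b.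
Proof.
move=> fa gb; rewrite (_ : fcoef (f - g) = fcoef f - fcoef g) // seriesD seriesN.
exact: cvgB.
Qed.

Definition fabs f : fps R := Fps (fun n => `|f n|).

(** Each factor is a difference of two nonnegative series, [|f| - (|f| - f)]. *)
Lemma cvg_fmul f g (a b : R) :
    cvgn (series (fabs f)) -> cvgn (series (fabs g)) ->
    series f @ \oo --> a -> series g @ \oo --> b ->
  series (f * g) @ \oo --> a * b.
Proof.
move=> /cvg_ex[fa ffa] /cvg_ex[gb ggb] fla glb.
have fm : series (fabs f - f) @ \oo --> fa - a by exact: series_fpsB.
have gm : series (fabs g - g) @ \oo --> gb - b by exact: series_fpsB.
have abs0 h n : 0 <= fabs h n by rewrite /= normr_ge0.
have abs1 h n : 0 <= (fabs h - h) n by rewrite fpsBE /= subr_ge0 ler_norm.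
have fE : f = fabs f - (fabs f - f) by rewrite opprB addrC subrK.
have gE : g = fabs g - (fabs g - g) by rewrite opprB addrC subrK.
have -> : f * g = fabs f * fabs g - fabs f * (fabs g - g) -
    ((fabs f - f) * fabs g - (fabs f - f) * (fabs g - g)).
  by rewrite {1}fE {1}gE; ring.
have -> : a * b = fa * gb - fa * (gb - b) - ((fa - a) * gb - (fa - a) * (gb - b)).
  by ring.
by do 2! apply: series_fpsB; apply: cvg_fmul_nneg.
Qed.

Lemma pseries_dilate f (t : R) : pseries f t = series (dilate t f).
Proof. by congr series; apply/funext => n; rewrite dilateE mulrC. Qed.

(** The constant term is the limit of the sum at [0]; dividing by [t], the same
    holds for the next coefficients. *)
Lemma pseries_eq0 f (r : R) : 0 < r ->
    (forall t, 0 < t < r -> pseries f t @ \oo --> 0) ->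
  f = 0.
Proof.
move=> r0 f0.
have const0 (h : fps R) : (forall t, 0 < t < r -> pseries h t @ \oo --> 0) -> h 0%N = 0.
  move=> h0; pose s := r / 4.
  have s0 : 0 < s by rewrite /s; lra.
  have [M hM] : exists M, forall N, series (fun n => `|h n| * s ^+ n) N <= M.
    have cv : cvgn (pseries (fun i => `|h i|) s).
      apply: (@is_cvg_pseries_inside_norm _ _ (r / 2)).
        by apply/cvg_ex; exists 0; apply: h0; rewrite /=; apply/andP; split; lra.
      by rewrite !gtr0_norm; rewrite /s; lra.
    exists (limn (pseries (fun i => `|h i|) s)) => N.
    apply: nondecreasing_cvgn_le cv _; apply: series_nneg_homo => n.
    by rewrite mulr_ge0 // exprn_ge0 // ltW.
  have bound t : 0 < t < s -> `|h 0%N| <= t / s * M.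
    move=> /andP[t0 ts].
    have h0t : (fun N => `|pseries h t N.+1|) @ \oo --> (0 : R).
      have : (fun N => pseries h t N.+1) @ \oo --> (0 : R).
        rewrite (cvg_shiftS (pseries h t)); apply: h0.
        by apply/andP; split=> //; rewrite (lt_trans ts) // /s; lra.
      by move/cvg_norm; rewrite normr0.
    have h1 : (fun N => `|pseries h t N.+1| + t / s * M) @ \oo --> 0 + t / s * M.
      by apply: cvgD => //; exact: cvg_cst.
    rewrite add0r in h1; apply: (cvgr_to_ge h1); near=> N.
    have -> : h 0%N = pseries h t N.+1 - \sum_(i < N) h i.+1 * t ^+ i.+1.
      by rewrite /pseries series_ordE big_ord_recl /= expr0 mulr1 addrK.
    apply: le_trans (ler_normB _ _) _; rewrite lerD2l.
    apply: le_trans (ler_norm_sum _ _ _) _.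
    apply: le_trans (ler_wpM2l _ (hM N.+1)); last by rewrite divr_ge0 // ltW.
    rewrite series_ordE big_ord_recl mulrDr -[leLHS]add0r lerD //.
      by rewrite !mulr_ge0 ?invr_ge0 // ltW.
    rewrite mulr_sumr; apply: ler_sum => i _; rewrite normrM.
    rewrite [leRHS]mulrCA ler_wpM2l // normrX gtr0_norm // !exprS mulrA divfK ?gt_eqF //.
    by rewrite ler_pM2l // lerXn2r ?nnegrE ?ltW.
  apply/eqP; rewrite -normr_le0.
  have lim0 : (fun N => s / 2 * (@harmonic R N) / s * M) @ \oo --> (0 : R).
    have -> : (0 : R) = s / 2 * 0 / s * M by rewrite mulr0 !mul0r.
    apply: cvgM; last exact: cvg_cst; apply: cvgM; last exact: cvg_cst.
    by apply: cvgM; [exact: cvg_cst|exact: cvg_harmonic].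
  apply: (cvgr_to_ge lim0); near=> N; apply: bound.
  have hN : 0 < @harmonic R N <= 1.
    by rewrite harmonic_gt0 /= /harmonic invf_le1 // ler1n.
  case/andP: hN => hN0 hN1; apply/andP; split; first by rewrite mulr_gt0 //; lra.
  by apply: (@le_lt_trans _ _ (s / 2)); [rewrite ler_piMr //; lra|lra].
suff H n (h : fps R) : (forall t, 0 < t < r -> pseries h t @ \oo --> 0) -> h n = 0.
  by apply: fpsP => n; exact: H.
elim: n h => [|n IH] h h0; first exact: const0.
apply: (IH (Fps (fun n => h n.+1))) => t tr.
have /andP[t0 _] := tr.
have hE N : pseries (fun n => h n.+1) t N = t^-1 * pseries h t N.+1.
  rewrite /pseries !series_ordE [in RHS]big_ord_recl /= (const0 h h0) mul0r add0r mulr_sumr.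
  by apply: eq_bigr => i _; rewrite /= exprS [RHS]mulrCA mulKf ?gt_eqF.
rewrite (_ : pseries _ t = (fun N => t^-1 * pseries h t N.+1)); last first.
  by apply/funext => N; rewrite -hE.
rewrite -[X in _ --> X](mulr0 t^-1); apply: cvgM; first exact: cvg_cst.
by rewrite (cvg_shiftS (pseries h t)); exact: h0.
Unshelve. all: by end_near. Qed.

Lemma cvg_series_exp (t : R) : series (dilate t (exp_series R)) @ \oo --> expR t.
Proof.
rewrite -pseries_dilate expRE.
by have := @is_cvg_series_exp_coeff R t; rewrite exp_coeffE.
Qed.

(** For small positive [t] the product series converges to [t]. *)
Lemma bernoulli_series B : bernoulli_numbers B ->
  bern_series B * (exp_series R - 1) = fX.
Proof.
move=> [r /= r0 hr]; apply/eqP; rewrite -subr_eq0; apply/eqP.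
have hB t : 0 < t < r -> pseries (bern_series B) t @ \oo --> t / (expR t - 1).
  move=> /andP[t0 tr]; apply: hr; last by rewrite gt_eqF.
  by rewrite /ball_ /= sub0r normrN gtr0_norm.
apply: (@pseries_eq0 _ (r / 2)); first by lra.
move=> t /andP[t0 tr].
have cb : cvgn (series (fabs (dilate t (bern_series B)))).
  have := @is_cvg_pseries_inside_norm _ (bern_series B) (t + r / 4) t.
  rewrite (_ : pseries _ t = series (fabs (dilate t (bern_series B)))).
    apply.
      apply/cvg_ex; eexists; apply: hB; apply/andP; split; lra.
    by rewrite !gtr0_norm; lra.
  congr series; apply/funext => n.
  by rewrite [RHS]/= normrM normrX (gtr0_norm t0) mulrC.
have ce : cvgn (series (fabs (dilate t (exp_series R - 1)))).
  apply: (@series_le_cvg _ _ (dilate t (exp_series R))).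
  - by move=> n; rewrite /= normr_ge0.
  - by move=> n; rewrite dilateE mulr_ge0 ?exprn_ge0 ?invr_ge0 // ltW.
  - move=> n; rewrite [leLHS]/= normrM normrX gtr0_norm // ler_wpM2l ?exprn_ge0 ?(ltW t0) //.
    by case: n => [|n] /=; rewrite ?subr0 ?invr1 ?subrr ?normr0 // ger0_norm.
  - by apply/cvg_ex; exists (expR t); exact: cvg_series_exp.
have c1 : series (dilate t (1 : fps R)) @ \oo --> (1 : R).
  rewrite dilate1 -(cvg_shiftS (series _)) /=.
  under eq_fun do rewrite series_ordE big_ord_recl big1 ?addr0 //.
  exact: cvg_cst.
have cX : series (dilate t (fX : fps R)) @ \oo --> t.
  rewrite -(cvg_shiftn 2 (series _)) /=.
  under eq_fun => N.
    rewrite addn2 series_ordE !big_ord_recl big1 ?addr0 => [|i _]; last by rewrite /= mulr0.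
    rewrite /= mulr0 add0r expr1 mulr1.
    over.
  exact: cvg_cst.
rewrite pseries_dilate dilateB dilateM.
have et : expR t - 1 != 0.
  by rewrite subr_eq0 gt_eqF // expR_gt1.
have -> : (0 : R) = t / (expR t - 1) * (expR t - 1) - t by rewrite divfK // subrr.
apply: series_fpsB => //; apply: cvg_fmul => //.
  by rewrite -pseries_dilate; apply: hB; apply/andP; split; lra.
rewrite dilateB; apply: series_fpsB => //; exact: cvg_series_exp.
Qed.

End SeriesProduct.

(** * Truncated star sums and strict sums *)

Section StarSums.
Variable R : realType.

(** The star sum restricted to [m_1 <= N]. *)
Fixpoint trunc_star (s : seq nat) (N : nat) : R :=
  if s is k :: s' then \sum_(1 <= m < N.+1) m%:R ^- k * trunc_star s' m else 1.

Lemma trunc_star0 k s : trunc_star (k :: s) 0 = 0.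
Proof. by rewrite /= big_geq. Qed.

Lemma trunc_starS k s N :
  trunc_star (k :: s) N.+1 = trunc_star (k :: s) N + N.+1%:R ^- k * trunc_star s N.+1.
Proof. by rewrite /= big_nat_recr. Qed.

Definition trunc_insertions (s : seq nat) N : R :=
  \sum_(u <- insertions2 s) trunc_star u N.

Lemma insertions2_cons k s :
  insertions2 (k :: s) = (2 :: k :: s)%N :: [seq k :: u | u <- insertions2 s].
Proof.
rewrite /insertions2 -map_comp.
rewrite -[iota 0 (size (k :: s)).+1]/(0 :: iota (1 + 0) (size s).+1)%N map_cons.
by rewrite iotaDl -map_comp.
Qed.

Lemma trunc_insertions0 s : trunc_insertions s 0 = 0.
Proof.
rewrite /trunc_insertions /insertions2 big_map big1_seq // => p _.
by case: (take p s) => [|k u] /=; rewrite big_geq.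
Qed.

Lemma trunc_insertions_nilS N : trunc_insertions [::] N.+1 =
  trunc_insertions [::] N + N.+1%:R ^- 2 * trunc_star [::] N.+1.
Proof.
by rewrite /trunc_insertions -[insertions2 [::]]/[:: [:: 2%N]] !big_seq1 trunc_starS.
Qed.

Lemma trunc_insertions_consS k s N : trunc_insertions (k :: s) N.+1 =
  trunc_insertions (k :: s) N + N.+1%:R ^- 2 * trunc_star (k :: s) N.+1
    + N.+1%:R ^- k * trunc_insertions s N.+1.
Proof.
have consE M : trunc_insertions (k :: s) M =
    trunc_star (2 :: k :: s)%N M + \sum_(u <- insertions2 s) trunc_star (k :: u) M.
  by rewrite /trunc_insertions insertions2_cons big_cons big_map.
rewrite !consE trunc_starS -!addrA; congr (_ + _).
rewrite [RHS]addrCA; congr (_ + _); rewrite /trunc_insertions mulr_sumr -big_split.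
by apply: eq_bigr => u _; rewrite trunc_starS.
Qed.

(** Generating series, in the variable [X = x ^ 4]: [starA] for the words
    [{3,1}^n], [starB] for the words [1,{3,1}^n], and [starC], [starD] for the sums
    over the insertions of [2] in these words. *)
Definition starA N : fps R := Fps (fun n => trunc_star (string31 n) N).
Definition starB N : fps R := Fps (fun n => trunc_star (1%N :: string31 n) N).
Definition starC N : fps R := Fps (fun n => trunc_insertions (string31 n) N).
Definition starD N : fps R := Fps (fun n => trunc_insertions (1%N :: string31 n) N).

Local Notation r N := (fconst (N.+1%:R^-1 : R)).

Let rXM (c : R) i f n : (fconst c ^+ i * f) n = c ^+ i * f n.
Proof. by rewrite -rmorphXn fpsCME. Qed.

Let rXMX (c : R) i f : (fconst c ^+ i * (fX * f)) 0%N = 0.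
Proof. by rewrite rXM fpsXM0 mulr0. Qed.

Let rXMXS (c : R) i f n : (fconst c ^+ i * (fX * f)) n.+1 = c ^+ i * f n.
Proof. by rewrite rXM fpsXMS. Qed.

Lemma starA0 : starA 0 = 1.
Proof. by apply: fpsP => -[|n] //=; rewrite big_geq. Qed.
Lemma starB0 : starB 0 = 0.
Proof. by apply: fpsP => n /=; rewrite big_geq. Qed.
Lemma starC0 : starC 0 = 0.
Proof. by apply: fpsP => n; exact: trunc_insertions0. Qed.
Lemma starD0 : starD 0 = 0.
Proof. by apply: fpsP => n; exact: trunc_insertions0. Qed.

Lemma starAS N : starA N.+1 = starA N + r N ^+ 3 * (fX * starB N.+1).
Proof.
apply: fpsP => -[|n]; rewrite fpsDE ?rXMX ?addr0 // rXMXS exprVn.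
exact: (trunc_starS 3 (1%N :: string31 n)).
Qed.

Lemma starBS N : starB N.+1 = starB N + r N * starA N.+1.
Proof.
apply: fpsP => n; rewrite fpsDE fpsCME -[N.+1%:R^-1]expr1 exprVn.
exact: trunc_starS.
Qed.

Lemma starCS N :
  starC N.+1 = starC N + r N ^+ 2 * starA N.+1 + r N ^+ 3 * (fX * starD N.+1).
Proof.
apply: fpsP => -[|n]; rewrite !fpsDE rXM ?rXMX ?addr0 ?rXMXS !exprVn.
  exact: trunc_insertions_nilS.
exact: (trunc_insertions_consS 3 (1%N :: string31 n)).
Qed.

Lemma starDS N :
  starD N.+1 = starD N + r N ^+ 2 * starB N.+1 + r N * starC N.+1.
Proof.
apply: fpsP => n; rewrite !fpsDE rXM fpsCME exprVn.
by have := trunc_insertions_consS 1 (string31 n) N; rewrite expr1.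
Qed.

(** The same generating series for the strict sums, [m_1 > m_2 > ...]. *)
Fixpoint strict N : (fps R * fps R) * (fps R * fps R) :=
  if N is N'.+1 then
    let: ((al, be), (ga, de)) := strict N' in
    ((al + r N' ^+ 3 * (fX * be), be + r N' * al),
     (ga + r N' ^+ 2 * al + r N' ^+ 3 * (fX * de), de + r N' ^+ 2 * be + r N' * ga))
  else ((1, 0), (0, 0)).

Definition strictA N := (strict N).1.1.
Definition strictB N := (strict N).1.2.
Definition strictC N := (strict N).2.1.
Definition strictD N := (strict N).2.2.

Lemma strictAS N : strictA N.+1 = strictA N + r N ^+ 3 * (fX * strictB N).
Proof. by rewrite /strictA /strictB /=; case: (strict N) => -[? ?] [? ?]. Qed.
Lemma strictBS N : strictB N.+1 = strictB N + r N * strictA N.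
Proof. by rewrite /strictA /strictB /=; case: (strict N) => -[? ?] [? ?]. Qed.
Lemma strictCS N : strictC N.+1 =
  strictC N + r N ^+ 2 * strictA N + r N ^+ 3 * (fX * strictD N).
Proof. by rewrite /strictA /strictC /strictD /=; case: (strict N) => -[? ?] [? ?]. Qed.
Lemma strictDS N : strictD N.+1 =
  strictD N + r N ^+ 2 * strictB N + r N * strictC N.
Proof. by rewrite /strictB /strictC /strictD /=; case: (strict N) => -[? ?] [? ?]. Qed.

Lemma geometric_inv (c : R) : (1 - fconst c * fX) * Fps (fun k => c ^+ k) = 1.
Proof.
rewrite mulrBl mul1r -mulrA; apply: fpsP => -[|k]; rewrite fpsBE fpsCME.
  by rewrite fpsXM0 mulr0 subr0 /= expr0.
by rewrite fpsXMS /= exprS subrr.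
Qed.

(** The product of the determinants [1 - x ^ 4 / m ^ 4] of the two-by-two matrices
    that add the level [m]. *)
Definition detprod N : fps R := eprod (fun j => - j.+1%:R ^- 4) N.

Definition power_sums N : fps R := Fps (fun k => \sum_(j < N) j.+1%:R ^- (4 * k + 2)).

Let det N := 1 - r N ^+ 4 * fX.

Let detprodS N : detprod N.+1 = detprod N * det N.
Proof.
rewrite /detprod eprodS /det; congr (_ * (_ + _)).
by rewrite rmorphN mulNr -exprVn rmorphXn.
Qed.

Let det_cancel N (f g : fps R) : det N * f = det N * g -> f = g.
Proof.
have := geometric_inv (N.+1%:R^-1 ^+ 4); rewrite rmorphXn -/(det N) => h fg.
have cancel x : Fps (fun k => (N.+1%:R^-1 ^+ 4) ^+ k) * (det N * x) = x.
  by rewrite mulrA [_ * det N]mulrC h mul1r.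
by rewrite -(cancel f) fg cancel.
Qed.

Let power_sumsS N : det N * power_sums N.+1 = det N * power_sums N + r N ^+ 2.
Proof.
have -> : power_sums N.+1 = power_sums N +
    r N ^+ 2 * Fps (fun k => (N.+1%:R^-1 ^+ 4) ^+ k).
  apply: fpsP => k; rewrite fpsDE rXM /= big_ord_recr /=; congr (_ + _).
  by rewrite addnC exprD exprM invfM !exprVn.
have := geometric_inv (N.+1%:R^-1 ^+ 4); rewrite rmorphXn -/(det N) => h.
by rewrite mulrDr [_ * (r N ^+ 2 * _)]mulrCA h mulr1.
Qed.

Let det_starA N : det N * starA N.+1 = starA N + r N ^+ 3 * (fX * starB N).
Proof. by rewrite mulrBl mul1r {1}starAS starBS; ring. Qed.

Let det_starB N : det N * starB N.+1 = starB N + r N * starA N.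
Proof. by rewrite mulrBl mul1r {1}starBS starAS; ring. Qed.

(** [det_m (1 - Z_m) ^ -1 = 1 + Z_m]. *)
Lemma strict_starAB N :
  detprod N * starA N = strictA N /\ detprod N * starB N = strictB N.
Proof.
elim: N => [|N [IHA IHB]].
  by rewrite /detprod /eprod big_ord0 starA0 starB0 mulr0 mulr1.
rewrite detprodS -!mulrA det_starA det_starB strictAS strictBS -IHA -IHB.
by split; ring.
Qed.

(** In a star sum the level [m] contributes [(1 - Z_m) ^ -1 = (1 + Z_m) / det_m],
    where [1 + Z_m] is its contribution to a strict sum. The letter [2] acts as a
    scalar [x ^ 2 / m ^ 2]; inserted at the level [m], it contributes
    [(1 + Z_m) ^ 2 / det_m ^ 2 = (2 (1 + Z_m) / det_m - 1) / det_m]. *)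
Lemma strict_starCD N :
  detprod N * starC N = 2%:R * power_sums N * strictA N - strictC N /\
  detprod N * starD N = 2%:R * power_sums N * strictB N - strictD N.
Proof.
elim: N => [|N [IHC IHD]].
  rewrite starC0 starD0 !mulr0 subr0.
  have -> : power_sums 0 = 0 by apply: fpsP => k; rewrite /= big_ord0.
  by rewrite !mulr0 !mul0r subr0.
have [hA hB] := strict_starAB N.+1.
split; apply: (@det_cancel N).
- have -> : det N * (detprod N.+1 * starC N.+1) = det N * (detprod N * starC N)
      + r N ^+ 2 * (detprod N.+1 * starA N.+1)
      + r N ^+ 3 * (fX * (det N * (detprod N * starD N)
          + r N ^+ 2 * (detprod N.+1 * starB N.+1))).
    (* Eliminating [starD N.+1] makes the determinant appear. *)
    have h : det N * starC N.+1 = starC N + r N ^+ 2 * starA N.+1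
        + r N ^+ 3 * (fX * (starD N + r N ^+ 2 * starB N.+1)).
      by rewrite mulrBl mul1r {1}starCS starDS; ring.
    rewrite !detprodS -!mulrA h; ring.
  have -> : det N * (2%:R * power_sums N.+1 * strictA N.+1 - strictC N.+1) =
      2%:R * (det N * power_sums N.+1) * strictA N.+1 - det N * strictC N.+1.
    by ring.
  by rewrite IHC IHD hA hB power_sumsS strictAS strictBS strictCS /det; ring.
- have -> : det N * (detprod N.+1 * starD N.+1) = det N * (detprod N * starD N)
      + r N ^+ 2 * (detprod N.+1 * starB N.+1)
      + r N * (det N * (detprod N * starC N)
          + r N ^+ 2 * (detprod N.+1 * starA N.+1)).
    have h : det N * starD N.+1 = starD N + r N ^+ 2 * starB N.+1
        + r N * (starC N + r N ^+ 2 * starA N.+1).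
      by rewrite mulrBl mul1r {1}starDS starCS; ring.
    rewrite !detprodS -!mulrA h; ring.
  have -> : det N * (2%:R * power_sums N.+1 * strictB N.+1 - strictD N.+1) =
      2%:R * (det N * power_sums N.+1) * strictB N.+1 - det N * strictD N.+1.
    by ring.
  by rewrite IHC IHD hA hB power_sumsS strictAS strictBS strictDS /det; ring.
Qed.

End StarSums.

(** * Closed forms for the strict sums *)

Section StrictLimits.
Variable R : realType.
Local Open Scope classical_set_scope.
Local Notation sh := (sinhc R).

Let K := fps R.

(** The substitution [X |-> - 4 X ^ 2], where the new variable is the parameter
    [w] of the factorization below. *)
Definition subst (f : fps R) : fps R :=
  Fps (fun n => if odd n then 0 else (-4) ^+ n./2 * f n./2).

Lemma subst_even f n : subst f n.*2 = (-4) ^+ n * f n.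
Proof. by rewrite /= odd_double doubleK. Qed.

Lemma substD f g : subst (f + g) = subst f + subst g.
Proof.
by apply: fpsP => n; rewrite fpsDE /=; case: odd; rewrite ?addr0 // mulrDr.
Qed.

Lemma substB f g : subst (f - g) = subst f - subst g.
Proof.
by apply: fpsP => n; rewrite fpsBE /=; case: odd; rewrite ?subr0 // mulrBr.
Qed.

Lemma substMn f m : subst (f *+ m) = subst f *+ m.
Proof.
apply: fpsP => n; rewrite fpsMnE /=; case: odd; first by rewrite mul0rn.
by rewrite fpsMnE mulrnAr.
Qed.

Lemma subst1 : subst 1 = 1.
Proof.
apply: fpsP => -[|n]; rewrite /= ?mulr1 ?expr0 //.
by case: ifP => // /negbT; rewrite negbK; case: n => // n _; rewrite /= mulr0.
Qed.

Lemma subst0 : subst 0 = 0.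
Proof. by apply: fpsP => n /=; rewrite mulr0 if_same. Qed.

Lemma substX f : subst (fX * f) = - 4%:R * fX ^+ 2 * subst f.
Proof.
have -> : - 4%:R * fX ^+ 2 * subst f = fconst (- 4%:R) * (fX * (fX * subst f)).
  by rewrite rmorphN rmorph_nat; ring.
apply: fpsP => n; rewrite fpsCME.
case: n => [|[|n]].
- by rewrite fpsXM0 mulr0 -[0%N]/(0.*2) subst_even fpsXM0 mulr0.
- by rewrite fpsXMS fpsXM0 mulr0.
have -> : subst (fX * f) n.+2 =
    if odd n then 0 else (-4) ^+ n./2.+1 * (fX * f) n./2.+1 by rewrite /= negbK.
by rewrite !fpsXMS /=; case: odd; rewrite ?mulr0 // exprS mulrA.
Qed.

Local Notation P := (eprod (fun j => - j.+1%:R ^- 2) : nat -> K).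
Local Notation Pb := (eprod (fun j => j.+1%:R ^- 2) : nat -> K).
Local Notation inc := (@increments K).

Let F : fps K := inc P.
Let Fb : fps K := inc Pb.
Let E : fps K := inc (fun N => fderiv (P N)).
Let Eb : fps K := inc (fun N => - fderiv (Pb N)).

Lemma fps_torsion_free (f : fps R) n : f *+ n.+1 = 0 -> f = 0.
Proof.
move=> fn0; apply: fpsP => k; have : (f *+ n.+1) k = 0 by rewrite fn0.
by rewrite fpsMnE => /eqP; rewrite mulrn_eq0 => /eqP.
Qed.

Let natVX (m k : nat) : m.+1%:R^-1 ^+ k *+ m.+1 ^ k = 1 :> R.
Proof. by rewrite -mulr_natr natrX -exprMn mulVf ?expr1n // pnatr_eq0. Qed.

Let rMn m k (f : K) : (fconst (m.+1%:R^-1) ^+ k * f) *+ m.+1 ^ k = f.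
Proof.
have c1 : fconst (m.+1%:R^-1) ^+ k *+ m.+1 ^ k = 1 :> K.
  by rewrite -rmorphXn -raddfMn natVX -fconst1.
by rewrite -mulrnAl c1 mul1r.
Qed.

Let dP m : (P m.+1 - P m) *+ m.+1 ^ 2 = - fX * P m.
Proof.
have -> : P m.+1 - P m = - (fconst (m.+1%:R^-1) ^+ 2 * (fX * P m)).
  by rewrite eprodS rmorphN -exprVn rmorphXn; ring.
by rewrite mulNrn rMn mulNr.
Qed.

Let dPb m : (Pb m.+1 - Pb m) *+ m.+1 ^ 2 = fX * Pb m.
Proof.
have -> : Pb m.+1 - Pb m = fconst (m.+1%:R^-1) ^+ 2 * (fX * Pb m).
  by rewrite eprodS -exprVn rmorphXn; ring.
by rewrite rMn.
Qed.

Let HF : theta (theta F) = - fconst fX * (tail1 * F).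
Proof.
rewrite [LHS](@theta_increments _ 2 P (fun m => - fX * P m)) //.
by rewrite incrementsZ rmorphN mulrCA.
Qed.

Let HFb : theta (theta Fb) = fconst fX * (tail1 * Fb).
Proof.
rewrite [LHS](@theta_increments _ 2 Pb (fun m => fX * Pb m)) //.
by rewrite incrementsZ mulrCA.
Qed.

Let HE : theta (theta E) = - (tail1 * F) - fconst fX * (tail1 * E).
Proof.
rewrite [LHS](@theta_increments _ 2 _ (fun m => - 1 * P m + - fX * fderiv (P m))) //.
  by rewrite incrementsD !incrementsZ !fconstN fconst1 /E /F; ring.
have dX : fderiv (- fX : K) = - 1 by rewrite raddfN /= fderivX.
move=> m; rewrite -[fderiv _ - _]raddfB -raddfMn /= dP fderivM dX.
by ring.
Qed.

Let HEb : theta (theta Eb) = - (tail1 * Fb) + fconst fX * (tail1 * Eb).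
Proof.
rewrite [LHS](@theta_increments _ 2 _ (fun m => - 1 * Pb m + fX * - fderiv (Pb m))) //.
  by rewrite incrementsD !incrementsZ !fconstN fconst1 /Eb /Fb; ring.
move=> m; rewrite -opprD -[fderiv _ - _]raddfB mulNrn -raddfMn /= dPb fderivM fderivX.
by ring.
Qed.

Local Notation sA := (fun N => subst (strictA R N)).
Local Notation sB := (fun N => subst (strictB R N)).
Local Notation sC := (fun N => subst (strictC R N)).
Local Notation sD := (fun N => subst (strictD R N)).

Let W4 := - 4%:R * fX ^+ 2 : K.

Let dA m : (sA m.+1 - sA m) *+ m.+1 ^ 3 = W4 * sB m.
Proof. by rewrite -substB -substMn strictAS addrC addKr rMn substX. Qed.

Let dB m : (sB m.+1 - sB m) *+ m.+1 ^ 1 = sA m.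
Proof.
by rewrite -substB -substMn strictBS addrC addKr -[fconst _]expr1 rMn.
Qed.

Let dC m : (sC m.+1 - sC m) *+ m.+1 ^ 3 = sA m *+ m.+1 + W4 * sD m.
Proof.
rewrite -substB -substMn.
have -> : strictC R m.+1 - strictC R m = fconst (m.+1%:R^-1) ^+ 2 * strictA R m +
    fconst (m.+1%:R^-1) ^+ 3 * (fX * strictD R m) by rewrite strictCS; ring.
rewrite mulrnDl rMn substD substX.
by rewrite expnSr mulrnA rMn substMn.
Qed.

Let dD m : (sD m.+1 - sD m) *+ m.+1 ^ 2 = sB m + sC m *+ m.+1.
Proof.
rewrite -substB -substMn.
have -> : strictD R m.+1 - strictD R m = fconst (m.+1%:R^-1) ^+ 2 * strictB R m +
    fconst (m.+1%:R^-1) ^+ 1 * strictC R m by rewrite strictDS; ring.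
rewrite mulrnDl rMn substD.
by rewrite expnSr mulrnA -{2}(expn1 m.+1) rMn substMn.
Qed.

Let F0 : F 0%N = 1. Proof. by rewrite /= /eprod big_ord0. Qed.
Let Fb0 : Fb 0%N = 1. Proof. by rewrite /= /eprod big_ord0. Qed.
Let E0 : E 0%N = 0.
Proof. by rewrite /E /increments /eprod big_ord0 -[LHS]/(fderiv (fconst 1)) fderivC. Qed.
Let Eb0 : Eb 0%N = 0.
Proof.
by rewrite /Eb /increments /eprod big_ord0 -[LHS]/(- fderiv (fconst 1)) fderivC oppr0.
Qed.

Let HB : theta (inc sB) = tail1 * inc sA.
Proof. exact: (@theta_increments _ 1 sB sA). Qed.

Let HA : theta (theta (theta (inc sA))) =
  fconst (- 4%:R * fX ^+ 2) * (tail1 * inc sB).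
Proof.
rewrite [LHS](@theta_increments _ 3 sA (fun m => W4 * sB m)) //.
by rewrite incrementsZ mulrCA.
Qed.

Let HC : theta (theta (theta (inc sC))) =
  theta (tail1 * inc sA) + fconst (- 4%:R * fX ^+ 2) * (tail1 * inc sD).
Proof.
rewrite [LHS](@theta_increments _ 3 sC (fun m => sA m *+ m.+1 + W4 * sD m)) //.
by rewrite incrementsD mulrDr -incrementsMn incrementsZ mulrCA.
Qed.

Let HD : theta (theta (inc sD)) = tail1 * inc sB + theta (tail1 * inc sC).
Proof.
rewrite [LHS](@theta_increments _ 2 sD (fun m => sB m + sC m *+ m.+1)) //.
by rewrite incrementsD mulrDr -incrementsMn.
Qed.

(** The increments of the strict sums are the Taylor coefficients of multiple
    polylogarithms, and the recurrences of the sums are the system solved by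
    [F * Fb]. *)
Lemma strictA_factor : inc sA = F * Fb.
Proof.
apply: (system0_solution fps_torsion_free F0 Fb0 HF HFb _ _ HB HA).
- by rewrite /= subst1.
- by rewrite /= subst0.
Qed.

Lemma strictC_factor : 2%:R * inc sC = - (E * Fb + F * Eb).
Proof.
apply: (system1_solution fps_torsion_free F0 Fb0 HF HFb _ _ HB HA E0 Eb0 HE HEb _ _ HC HD).
- by rewrite /= subst1.
- by rewrite /= subst0.
- by rewrite /= subst0.
- by rewrite /= subst0.
Qed.

(** Absolute convergence at [t = 1] of a series in [t] with coefficients in [K],
    read in each degree separately. *)
Definition tsum_cvg (f : fps K) (L : K) := forall k,
  cvgn (series (fabs (Fps (fun j => f j k)))) /\ series (fun j => f j k) @ \oo --> L k.

Lemma tsum_cvgM (f g : fps K) (L M : K) : tsum_cvg f L -> tsum_cvg g M ->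
  forall k, series (fun j => (f * g) j k) @ \oo --> (L * M) k.
Proof.
move=> fL gM k.
have -> : series (fun j => (f * g) j k) = (fun N => \sum_(l < k.+1)
    series (Fps (fun j => f j l) * Fps (fun j => g j (k - l)%N)) N).
  apply/funext => N; rewrite series_ordE.
  under [RHS]eq_bigr do rewrite series_ordE.
  rewrite exchange_big /=; apply: eq_bigr => j _.
  by rewrite fps_sumE exchange_big.
apply: (@cvg_sum_ord _ k.+1 (fun N l =>
   series (Fps (fun j => f j l) * Fps (fun j => g j (k - l)%N)) N)
   (fun l => L l * M (k - l)%N)) => l _.
have [cf fl] := fL l; have [cg gl] := gM (k - l)%N.
exact: cvg_fmul.
Qed.

(** The terms of fixed degree [k] have a constant sign [e k], so that their
    convergence is absolute. *)
Lemma tsum_increments (Q : nat -> K) (L : K) (e : nat -> R) :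
    coef_cvg Q L -> (forall j k, `|inc Q j k| = e k * inc Q j k) ->
  tsum_cvg (inc Q) L.
Proof.
move=> QL He k.
have h : series (fun j => inc Q j k) @ \oo --> L k.
  rewrite -cvg_shiftS; under eq_fun do rewrite series_ordE -fps_sumE sum_increments.
  exact: QL.
split=> //; apply/cvg_ex; exists (e k * L k).
have -> : series (fabs (Fps (fun j => inc Q j k))) =
    (fun N => e k * series (fun j => inc Q j k) N).
  apply/funext => N; rewrite !series_ordE mulr_sumr; apply: eq_bigr => j _.
  by rewrite [LHS]/= -He.
by apply: cvgM => //; exact: cvg_cst.
Qed.

Let cP : coef_cvg P (dilate (- pi ^+ 2) sh).
Proof. exact: euler_sin. Qed.

Let cPb : coef_cvg Pb (dilate (pi ^+ 2) sh).
Proof. exact: euler_sinh. Qed.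

Let P_Pb N : P N = dilate (-1) (Pb N).
Proof. by rewrite -eprod_scale; congr eprod; apply/funext => j; rewrite mulN1r. Qed.

Let Fb_ge0 j k : 0 <= Fb j k.
Proof.
have c0 i : 0 <= i.+1%:R ^- 2 :> R by rewrite invr_ge0 sqr_ge0.
case: j => [|j]; first exact: eprod_ge0.
by rewrite -[Fb _]/(Pb j.+1 - Pb j) fpsBE subr_ge0 eprod_homo.
Qed.

Let F_Fb j : F j = dilate (-1) (Fb j).
Proof. by case: j => [|j] /=; rewrite !P_Pb // -dilateB. Qed.

Let E_F j : E j = fderiv (F j).
Proof. by case: j => [|j] //=; rewrite raddfB. Qed.

Let Eb_Fb j : Eb j = - fderiv (Fb j).
Proof. by case: j => [|j] //=; rewrite raddfB opprB opprK addrC. Qed.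

Let tF : tsum_cvg F (dilate (- pi ^+ 2) sh).
Proof.
apply: (@tsum_increments _ _ (fun k => (-1) ^+ k)) => // j k.
by rewrite -/F F_Fb dilateE mulrA -expr2 sqrr_sign mul1r normrMsign ger0_norm.
Qed.

Let tFb : tsum_cvg Fb (dilate (pi ^+ 2) sh).
Proof.
apply: (@tsum_increments _ _ (fun k => 1)) => // j k.
by rewrite -/Fb mul1r ger0_norm.
Qed.

Let tE : tsum_cvg E (fderiv (dilate (- pi ^+ 2) sh)).
Proof.
apply: (@tsum_increments _ _ (fun k => (-1) ^+ k.+1)); first exact: coef_cvg_deriv.
move=> j k; rewrite -/E E_F fderivE F_Fb dilateE mulrnAr mulrA -expr2 sqrr_sign mul1r.
by rewrite normrMn normrMsign ger0_norm.
Qed.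

Let tEb : tsum_cvg Eb (- fderiv (dilate (pi ^+ 2) sh)).
Proof.
apply: (@tsum_increments _ _ (fun k => -1)).
  by apply: coef_cvgN; exact: coef_cvg_deriv.
move=> j k; rewrite -/Eb Eb_Fb fpsNE mulN1r opprK normrN fderivE.
by rewrite ger0_norm // mulrn_wge0.
Qed.

(** At [t = 1] the factorization gives the product of a sine and a hyperbolic sine. *)
Lemma strictA_cvg n : (fun N => strictA R N n) @ \oo -->
  (2 * pi ^+ (4 * n) / (4 * n + 2)`!%:R : R).
Proof.
have n4 : (-4) ^+ n != 0 :> R by rewrite expf_neq0 // oppr_eq0 pnatr_eq0.
have -> : (fun N => strictA R N n) = (fun N => (-4) ^- n * sA N n.*2).
  by apply/funext => N; rewrite subst_even mulKf.
have -> : 2 * pi ^+ (4 * n) / (4 * n + 2)`!%:R =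
    (-4) ^- n * (dilate (- pi ^+ 2) sh * dilate (pi ^+ 2) sh) n.*2 :> R.
  have -> : dilate (- pi ^+ 2) sh * dilate (pi ^+ 2) sh = dilate (pi ^+ 2) (wr0 R).
    by rewrite /wr0 dilateM dilate_dilate mulrN1 mulrC.
  rewrite dilateE wr0_even -exprM -muln2 (_ : 2 * (n * 2) = 4 * n)%N; last by lia.
  rewrite (mulrCA (pi ^+ _)) -!mulrA [(-4) ^- n * _]mulrCA; congr (_ * _).
  by rewrite mulKf.
apply: cvgM; first exact: cvg_cst.
have := @tsum_cvgM _ _ _ _ tF tFb n.*2; rewrite -strictA_factor -cvg_shiftS.
by under eq_fun do rewrite series_ordE -fps_sumE sum_increments.
Qed.

(** Here it gives the Wronskian of a sine and a hyperbolic sine. *)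
Lemma strictC_cvg n : (fun N => strictC R N n) @ \oo -->
  (pi ^+ (4 * n + 2) / (4 * n + 3)`!%:R : R).
Proof.
have n4 : (-4) ^+ n != 0 :> R by rewrite expf_neq0 // oppr_eq0 pnatr_eq0.
pose S := dilate (- pi ^+ 2) sh; pose Sb := dilate (pi ^+ 2) sh.
have lim2 : (fun N => (2%:R * sC N) n.*2) @ \oo -->
    - ((fderiv S * Sb) n.*2 + (S * - fderiv Sb) n.*2).
  have h : series (fun j => (2%:R * inc sC) j n.*2) @ \oo -->
      - ((fderiv S * Sb) n.*2 + (S * - fderiv Sb) n.*2).
    rewrite strictC_factor.
    rewrite (_ : (fun j => _) =
      - ((fun j => (E * Fb) j n.*2) + (fun j => (F * Eb) j n.*2))) //.
    rewrite seriesN seriesD; apply: cvgN; apply: cvgD.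
      exact: (tsum_cvgM tE tFb).
    exact: (tsum_cvgM tF tEb).
  rewrite -cvg_shiftS in h; apply: cvg_trans h.
  apply: near_eq_cvg; near=> N.
  rewrite -[LHS]/(series (fun j => (2%:R * inc sC) j n.*2) N.+1).
  have c2 : 2%:R = fconst (2%:R : K) :> fps K by rewrite rmorph_nat.
  by rewrite series_ordE -fps_sumE c2 -incrementsZ sum_increments.
have -> : (fun N => strictC R N n) = (fun N => (-4) ^- n / 2 * (2%:R * sC N) n.*2).
  apply/funext => N; rewrite mulr_natl fpsMnE subst_even.
  by rewrite -[X in _ = _ * X]mulr_natl -mulrA mulKf ?pnatr_eq0 // mulKf.
have -> : pi ^+ (4 * n + 2) / (4 * n + 3)`!%:R = (-4) ^- n / 2 *
    - ((fderiv S * Sb) n.*2 + (S * - fderiv Sb) n.*2) :> R.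
  have wr3E : (fX * (S * fderiv Sb - fderiv S * Sb)) *+ 2 =
      - dilate (pi ^+ 2) (wr3 R).
    have -> : fX * (S * fderiv Sb - fderiv S * Sb) =
        S * (fX * fderiv Sb) - (fX * fderiv S) * Sb by ring.
    rewrite !fX_deriv.
    have -> : S = dilate (pi ^+ 2) (sinc R) by rewrite /sinc dilate_dilate mulrN1.
    rewrite /Sb (theta_dilate _ (sinc R)) (theta_dilate _ sh) -!dilateM -dilateB.
    rewrite -dilateMn wronskian_sinc.
    by rewrite -mulN1r -[RHS]mulN1r dilateM; congr (_ * _); rewrite raddfN /= dilate1.
  have : ((fX * (S * fderiv Sb - fderiv S * Sb)) *+ 2) n.*2.+1 =
    (- dilate (pi ^+ 2) (wr3 R)) n.*2.+1 by rewrite wr3E.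
  rewrite fpsMnE fpsXMS fpsBE fpsNE dilateE wr3_odd => h2.
  rewrite (mulrN S) fpsNE.
  have -> : - ((fderiv S * Sb) n.*2 - (S * fderiv Sb) n.*2) =
      ((S * fderiv Sb) n.*2 - (fderiv S * Sb) n.*2) *+ 2 / 2.
    by field.
  rewrite h2 -exprM (_ : 2 * n.*2.+1 = 4 * n + 2)%N; last by lia.
  by rewrite exprS; field; rewrite n4 /= pnatr_eq0 -lt0n fact_gt0.
apply: cvgM => //; exact: cvg_cst.
Unshelve. all: by end_near. Qed.

End StrictLimits.

(** * The star sums as limits of truncated sums *)

Section StarLimit.
Variable R : realType.
Local Open Scope classical_set_scope.

(** The weakly decreasing words of length [r] with entries in [[1, N]]. *)
Fixpoint weakly_decreasing (r N : nat) : seq (seq nat) :=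
  if r is r'.+1 then
    [seq m :: l | m <- iota 1 N, l <- weakly_decreasing r' m]
  else [:: [::]].

Lemma mem_weakly_decreasing r N (m : seq nat) :
  (m \in weakly_decreasing r N) =
  [&& size m == r, sorted geq m, all (leq 1) m & all (fun x => x <= N)%N m].
Proof.
elim: r N m => [|r IH] N [|x m] //=.
  by apply/allpairsPdep => -[? [? []]].
have geq_trans : transitive geq by move=> a b c /= ab bc; exact: leq_trans bc ab.
rewrite path_sortedE // eqSS.
have -> : (x :: m \in [seq a :: l | a <- iota 1 N, l <- weakly_decreasing r a]) =
    (x \in iota 1 N) && (m \in weakly_decreasing r x).
  apply/allpairsPdep/andP => [[a [l [aN lr [-> ->]]]]//|[xN mx]].
  by exists x, m.
rewrite IH mem_iota add1n ltnS.
have -> : all (geq x) m = all (fun y => y <= x)%N m by [].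
apply/idP/idP.
  move=> /andP[/andP[x1 xN] /and4P[-> -> -> mx]] /=; rewrite x1 xN mx /=.
  by apply: sub_all mx => y /leq_trans; apply.
by move=> /and5P[-> /andP[-> ->] /andP[-> ->] -> _].
Qed.

Lemma uniq_weakly_decreasing r N : uniq (weakly_decreasing r N).
Proof.
elim: r N => //= r IH N; apply: allpairs_uniq_dep; first exact: iota_uniq.
- by move=> m _; exact: IH.
- by move=> [a l] [b l'] _ _ /= [-> ->].
Qed.

Lemma sum_weakly_decreasing (s : seq nat) N :
  \sum_(m <- weakly_decreasing (size s) N)
    \prod_(i < size s) (nth 0%N m i)%:R ^- nth 0%N s i = trunc_star R s N.
Proof.
elim: s N => [|k s IH] N /=; first by rewrite big_seq1 big_ord0.
rewrite big_allpairs_dep /index_iota subn1; apply: eq_bigr => m _.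
rewrite -IH mulr_sumr; apply: eq_bigr => l _.
by rewrite big_ord_recl.
Qed.

Lemma trunc_star_homo s M N : (M <= N)%N -> trunc_star R s M <= trunc_star R s N.
Proof.
case: s => [//|k s].
have ge0 t K : 0 <= trunc_star R t K.
  elim: t K => [|j t IH] K //=.
  by apply: sumr_ge0 => m _; rewrite mulr_ge0 // invr_ge0 exprn_ge0.
elim: N => [|N IH]; first by rewrite leqn0 => /eqP ->.
rewrite leq_eqVlt => /orP[/eqP -> //|]; rewrite ltnS => /IH /le_trans; apply.
by rewrite trunc_starS lerDl mulr_ge0 // invr_ge0 exprn_ge0.
Qed.

(** A finite set of indices lies in some [weakly_decreasing (size s) N]. *)
Lemma zeta_star_cvg s : (fun N => (trunc_star R s N)%:E) @ \oo --> zeta_star R s.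
Proof.
pose a (m : seq nat) : \bar R :=
  (\prod_(i < size s) (nth 0%N m i)%:R ^- nth 0%N s i)%:E.
have a0 m : (0 <= a m)%E.
  by rewrite lee_fin; apply: prodr_ge0 => i _; rewrite invr_ge0 exprn_ge0.
have sumE N :
    (\sum_(m \in [set` weakly_decreasing (size s) N]) a m)%E = (trunc_star R s N)%:E.
  by rewrite -fsbig_seq ?uniq_weakly_decreasing // sumEFin sum_weakly_decreasing.
have -> : zeta_star R s = ereal_sup (range (fun N => (trunc_star R s N)%:E)).
  apply/eqP; rewrite eq_le; apply/andP; split.
    apply: ge_ereal_sup => _ [A [finA AD] <-].
    have [t At] := (finite_seqP A).1 finA.
    pose N := (\max_(m <- t) \max_(x <- m) x)%N.
    apply: (@le_trans _ _ (trunc_star R s N)%:E); last first.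
      by apply: ereal_sup_ubound; exists N.
    rewrite -sumE; apply: lee_fsum_nneg_subset;
      [exact: finA|exact: finite_seq| |by move=> m _; exact: a0].
    move=> m; rewrite At !inE => mt.
    have [sm dm pm] : [/\ size m = size s, sorted geq m & all (leq 1) m].
      by apply: AD; rewrite At.
    rewrite /= mem_weakly_decreasing sm eqxx dm pm /=; apply/allP => x xm.
    apply: (@leq_trans (\max_(x <- m) x)%N).
      exact: (leq_bigmax_seq (F := id)).
    exact: (leq_bigmax_seq (F := fun m : seq nat => \max_(x <- m) x)%N).
  apply: ge_ereal_sup => _ [N _ <-]; rewrite -sumE; apply: ereal_sup_ubound.
  exists [set` weakly_decreasing (size s) N] => //; split; first exact: finite_seq.
  by move=> m /=; rewrite mem_weakly_decreasing => /and4P[/eqP -> -> ->].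
apply: ereal_nondecreasing_cvgn => M N MN.
by rewrite lee_fin trunc_star_homo.
Qed.

Lemma trunc_insertions_cvg s : (fun N => (trunc_insertions R s N)%:E) @ \oo -->
  (\sum_(u <- insertions2 s) zeta_star R u)%E.
Proof.
under eq_fun do rewrite /trunc_insertions -sumEFin.
apply: cvg_nnesum => u _; last exact: zeta_star_cvg.
near=> N; rewrite lee_fin; case: u => [//|k u].
by rewrite -(trunc_star0 R k u) trunc_star_homo.
Unshelve. all: by end_near. Qed.

End StarLimit.

(** * The value of the sum *)

Section Value.
Variables (R : realType) (B : nat -> R).
Hypothesis hB : bernoulli_numbers B.
Local Open Scope classical_set_scope.
Local Notation sh := (sinhc R).

Let S := dilate (- pi ^+ 2) sh.
Let Sb := dilate (pi ^+ 2) sh.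
Let kappa := csch_series B.
Let bE := bernoulli_series hB.

Let S_cvg : coef_cvg (eprod (fun j => - j.+1%:R ^- 2 : R)) S.
Proof. exact: euler_sin. Qed.

Let Sb_cvg : coef_cvg (eprod (fun j => j.+1%:R ^- 2 : R)) Sb.
Proof. exact: euler_sinh. Qed.

Let SV : dilate (- pi ^+ 2) kappa * S = 1.
Proof. by rewrite -dilateM csch_sinhc // dilate1. Qed.

Let SbV : dilate (pi ^+ 2) kappa * Sb = 1.
Proof. by rewrite -dilateM csch_sinhc // dilate1. Qed.

(** The determinants factor as [1 - X ^ 2 / m ^ 4 = (1 - X / m ^ 2)
    (1 + X / m ^ 2)]. *)
Let detprodE N : detprod R N =
  evens (eprod (fun j => - j.+1%:R ^- 2) N * eprod (fun j => j.+1%:R ^- 2) N).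
Proof.
elim: N => [|N IH].
  by rewrite /detprod /eprod !big_ord0 mulr1; apply: fpsP => -[|n].
rewrite /detprod !eprodS -/(detprod R N) IH.
pose c : R := N.+1%:R ^- 2.
rewrite -[N.+1%:R ^- 2]/c -mulrACA.
have fE : (1 + fconst (- c) * fX) * (1 + fconst c * fX) =
    1 - fconst (c ^+ 2) * (fX * fX).
  by rewrite fconstN rmorphXn; ring.
have f_odd : odd_vanishing (1 - fconst (c ^+ 2) * (fX * fX)).
  by move=> n; rewrite fpsBE fpsCME fpsXMS /=; case: n => [|n]; rewrite mulr0 subr0.
rewrite fE [RHS]evensM //; congr (_ * _); apply: fpsP => n.
rewrite evensE fpsDE fpsBE !fpsCME (_ : - N.+1%:R ^- 4 = - c ^+ 2); last first.
  by rewrite /c -[in RHS]exprVn -exprM -exprVn.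
by rewrite mulNr; case: n => [|[|n]]; rewrite ?fpsXM0 ?fpsXMS /= ?mulr0.
Qed.

Let Dlim := evens (S * Sb).
Let alphas := evens (dilate (- pi ^+ 2) kappa * dilate (pi ^+ 2) kappa).

Let detprod_cvg : coef_cvg (detprod R) Dlim.
Proof.
have h := coef_cvg_evens (coef_cvgM S_cvg Sb_cvg).
by move=> k; under eq_fun do rewrite detprodE; exact: h.
Qed.

Let alphasV : alphas * Dlim = 1.
Proof.
rewrite -evensM.
  have -> : dilate (- pi ^+ 2) kappa * dilate (pi ^+ 2) kappa * (S * Sb) =
    (dilate (- pi ^+ 2) kappa * S) * (dilate (pi ^+ 2) kappa * Sb) by ring.
  by rewrite SV SbV mulr1; apply: fpsP => -[|n].
have -> : S * Sb = dilate (pi ^+ 2) (sh * dilate (-1) sh).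
  by rewrite dilateM dilate_dilate mulrN1 mulrC.
by move=> n; rewrite dilateE odd_vanishing_symm mulr0.
Qed.

(** The signs of the two factors [2 - 2 ^ 2n] and [2 ^ 2n - 2] cancel in pairs. *)
Let alphasE N : alphas N = pi ^+ (4 * N) * alpha B N.
Proof.
rewrite /alphas evensE fpsME /alpha mulr_sumr -mul2n; apply: eq_bigr => i _.
have iN : (i <= 2 * N)%N by rewrite -ltnS.
have rN : (2 * N - i < (2 * N).+1)%N by rewrite ltnS leq_subr.
rewrite (big_pred1 (Ordinal rN)) => [|j]; last first.
  by apply/eqP/eqP => [h|->/=]; [apply/val_inj => /=; lia|lia].
rewrite !dilateE !csch_seriesE //=.
rewrite (exprNn (pi ^+ 2)) -!exprM.
have -> : (-1) ^+ (2 * N - i) = (-1) ^+ i :> R.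
  by rewrite -signr_odd oddB // oddM /= signr_odd.
have -> : pi ^+ (4 * N) = pi ^+ (2 * i) * pi ^+ (2 * (2 * N - i)) :> R.
  by rewrite -exprD; congr (_ ^+ _); lia.
ring.
Qed.

(** Its coefficient of degree [k] is [zeta (2k + 2)]. *)
Let zetas : fps R :=
  fconst (pi ^+ 2 / 2) * dilate (- pi ^+ 2) (Fps (fun k => coth_series B k.+1)).

(** The logarithmic derivative of Euler's product. *)
Let zetas_log : zetas * S = - fderiv S.
Proof.
pose cs : fps R := Fps (fun k => coth_series B k.+1).
have cs_shift : coth_series B = 1 + fX * cs.
  apply: fpsP => -[|k]; rewrite fpsDE ?fpsXM0 ?fpsXMS /= ?add0r // addr0.
  have := congr1 (fun f : fps R => f 0%N) (coth_sinhc bE).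
  by rewrite fpsM0E /= fact0 invr1 mulr1.
have csE : cs * sh = fderiv sh *+ 2.
  apply: fX_lreg; rewrite mulrA mulrnAr fX_deriv theta_sinhc -(coth_sinhc bE) cs_shift.
  ring.
rewrite /zetas -/cs /S -mulrA -dilateM csE fderiv_dilate dilateMn.
rewrite mulrnAr -mulrnAl -raddfMn /= -[_ *+ 2]mulr_natr divfK ?pnatr_eq0 //.
by rewrite fconstN mulNr opprK.
Qed.

Let zeta_sums N : fps R := Fps (fun k => \sum_(j < N) j.+1%:R ^- (2 * k + 2)).

Let zeta_sums_log N : eprod (fun j => - j.+1%:R ^- 2) N * zeta_sums N =
  - fderiv (eprod (fun j => - j.+1%:R ^- 2 : R) N).
Proof.
elim: N => [|N IH].
  rewrite /eprod big_ord0 -{2}fconst1 fderivC oppr0 mul1r.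
  by apply: fpsP => k /=; rewrite big_ord0.
set c : R := N.+1%:R ^- 2.
have -> : zeta_sums N.+1 = zeta_sums N + fconst c * Fps (fun k => c ^+ k).
  apply: fpsP => k; rewrite fpsDE fpsCME /= big_ord_recr /=; congr (_ + _).
  by rewrite -exprS /c -[in RHS]exprVn -exprM -exprVn; congr (_ ^+ _); lia.
have geo := geometric_inv c.
have dX : fderiv (1 + fconst (- c) * fX) = - fconst c.
  rewrite -fconst1 raddfD /= fderivC fderivM fderivC fderivX fconstN; ring.
rewrite eprodS -/c fderivM dX.
set p := eprod _ N in IH *; set q := Fps _ in geo *.
have -> : p * (1 + fconst (- c) * fX) * (zeta_sums N + fconst c * q) =
    p * zeta_sums N * (1 - fconst c * fX) + p * fconst c * ((1 - fconst c * fX) * q).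
  by rewrite fconstN; ring.
by rewrite IH geo fconstN; ring.
Qed.

Let power_sums_cvg k : (fun N => power_sums R N k) @ \oo -->
  (2 ^+ (4 * k + 1) * B (4 * k + 2)%N / (4 * k + 2)`!%:R * pi ^+ (4 * k + 2) : R).
Proof.
have h := coef_cvg_div zeta_sums_log (eprod0E _) S_cvg
  (coef_cvgN (coef_cvg_deriv S_cvg)) SV.
have lim : dilate (- pi ^+ 2) kappa * - fderiv S = zetas.
  by rewrite -zetas_log mulrCA SV mulr1.
rewrite lim in h; have := h (2 * k)%N.
have -> : (fun N => zeta_sums N (2 * k)%N) = (fun N => power_sums R N k).
  apply/funext => N /=; apply: eq_bigr => j _; congr (_ ^- _); lia.
have -> : zetas (2 * k)%N =
    pi ^+ 2 / 2 * ((- pi ^+ 2) ^+ (2 * k) * coth_series B (2 * k).+1).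
  by rewrite /zetas fpsCME dilateE.
rewrite coth_seriesE.
have -> : (2 * (2 * k).+1 = 4 * k + 2)%N by lia.
rewrite exprM sqrrN -exprM -exprM.
have -> : pi ^+ 2 / 2 * (pi ^+ (2 * (2 * k)) *
      (2 ^+ (4 * k + 2) * B (4 * k + 2)%N / (4 * k + 2)`!%:R)) =
    2 ^+ (4 * k + 1) * B (4 * k + 2)%N / (4 * k + 2)`!%:R * pi ^+ (4 * k + 2) :> R.
  have -> : pi ^+ (4 * k + 2) = pi ^+ 2 * pi ^+ (2 * (2 * k)) :> R.
    by rewrite -exprD; congr (_ ^+ _); lia.
  have -> : 2 ^+ (4 * k + 2) = 2 * 2 ^+ (4 * k + 1) :> R.
    by rewrite -exprS; congr (_ ^+ _); lia.
  by field; rewrite pnatr_eq0 -lt0n fact_gt0.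
by [].
Qed.

Lemma trunc_insertions_string31_cvg n :
  (fun N => trunc_insertions R (string31 n) N) @ \oo -->
  ((\sum_(k < n.+1)
      (2 ^+ (4 * k + 3) * B (4 * k + 2)%N / (4 * k + 2)`!%:R
         * (\sum_(i < (n - k).+1) alpha B (n - k - i) / (4 * i + 2)`!%:R)
       - alpha B (n - k) / (4 * k + 3)`!%:R))
   * pi ^+ (4 * n + 2) : R).
Proof.
pose H : fps R :=
  Fps (fun k => 2 ^+ (4 * k + 1) * B (4 * k + 2)%N / (4 * k + 2)`!%:R * pi ^+ (4 * k + 2)).
pose Al : fps R := Fps (fun i => 2 * pi ^+ (4 * i) / (4 * i + 2)`!%:R).
pose Ga : fps R := Fps (fun k => pi ^+ (4 * k + 2) / (4 * k + 3)`!%:R).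
have cH : coef_cvg (power_sums R) H by exact: power_sums_cvg.
have cAl : coef_cvg (strictA R) Al by exact: strictA_cvg.
have cGa : coef_cvg (strictC R) Ga by exact: strictC_cvg.
have cQ := coef_cvgD (coef_cvgM (coef_cvgM (@coef_cvg_cst R 2%:R) cH) cAl) (coef_cvgN cGa).
have dq N : detprod R N * starC R N =
    2%:R * power_sums R N * strictA R N - strictC R N.
  by have [] := strict_starCD R N.
have d0 N : detprod R N 0%N = 1 by exact: eprod0E.
have lim := coef_cvg_div dq d0 detprod_cvg cQ alphasV; have := lim n.
have -> : (alphas * (2%:R * H * Al - Ga)) n =
  (\sum_(k < n.+1)
      (2 ^+ (4 * k + 3) * B (4 * k + 2)%N / (4 * k + 2)`!%:R
         * (\sum_(i < (n - k).+1) alpha B (n - k - i) / (4 * i + 2)`!%:R)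
       - alpha B (n - k) / (4 * k + 3)`!%:R))
   * pi ^+ (4 * n + 2); last by [].
have -> : alphas * (2%:R * H * Al - Ga) = H *+ 2 * (Al * alphas) - Ga * alphas.
  by rewrite -[H *+ 2]mulr_natl; ring.
rewrite fpsBE !fpsME -sumrB mulr_suml; apply: eq_bigr => k _.
have kn : (k <= n)%N by rewrite -ltnS.
rewrite fpsMnE fpsME mulrBl; congr (_ - _).
  rewrite -[RHS]mulrA mulr_suml !mulr_sumr; apply: eq_bigr => i _.
  have ik : (i <= n - k)%N by rewrite -ltnS.
  rewrite alphasE /=.
  have -> : pi ^+ (4 * n + 2) =
      pi ^+ (4 * k + 2) * pi ^+ (4 * i) * pi ^+ (4 * (n - k - i)) :> R.
    by rewrite -!exprD; congr (_ ^+ _); lia.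
  have -> : 2 ^+ (4 * k + 3) = 2 * 2 * 2 ^+ (4 * k + 1) :> R.
    by rewrite -mulrA -!exprS; congr (_ ^+ _); lia.
  by field; rewrite !pnatr_eq0 -!lt0n !fact_gt0.
rewrite alphasE /=.
have -> : pi ^+ (4 * n + 2) = pi ^+ (4 * k + 2) * pi ^+ (4 * (n - k)) :> R.
  by rewrite -!exprD; congr (_ ^+ _); lia.
by field; rewrite !pnatr_eq0 -!lt0n !fact_gt0.
Qed.

Lemma sum_zeta_star n : (\sum_(s <- insertions2 (string31 n)) zeta_star R s)%E =
  ((\sum_(k < n.+1)
      (2 ^+ (4 * k + 3) * B (4 * k + 2)%N / (4 * k + 2)`!%:R
         * (\sum_(i < (n - k).+1) alpha B (n - k - i) / (4 * i + 2)`!%:R)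
       - alpha B (n - k) / (4 * k + 3)`!%:R))
   * pi ^+ (4 * n + 2))%:E.
Proof.
have h := @trunc_insertions_cvg R (string31 n).
rewrite -(cvg_lim (@ereal_hausdorff R) h); apply: cvg_lim; first exact: ereal_hausdorff.
by apply: cvg_EFin; [exact: nearW|exact: trunc_insertions_string31_cvg].
Qed.

(** * Rationality *)

Definition rational (x : R) := exists q : rat, x = ratr q.

Let rationalD x y : rational x -> rational y -> rational (x + y).
Proof. by move=> [p ->] [q ->]; exists (p + q); rewrite rmorphD. Qed.
Let rationalN x : rational x -> rational (- x).
Proof. by move=> [p ->]; exists (- p); rewrite rmorphN. Qed.
Let rationalM x y : rational x -> rational y -> rational (x * y).
Proof. by move=> [p ->] [q ->]; exists (p * q); rewrite rmorphM. Qed.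
Let rationalV x : rational x -> rational x^-1.
Proof. by move=> [p ->]; exists p^-1; rewrite fmorphV. Qed.
Let rational_nat n : rational n%:R.
Proof. by exists n%:R; rewrite rmorph_nat. Qed.
Let rationalX x n : rational x -> rational (x ^+ n).
Proof. by move=> [p ->]; exists (p ^+ n); rewrite rmorphXn. Qed.
Let rational_sum n (P : pred 'I_n) (F : 'I_n -> R) :
  (forall i, P i -> rational (F i)) -> rational (\sum_(i < n | P i) F i).
Proof.
move=> rF; apply: (big_ind rational) => //; first exact: (rational_nat 0).
Qed.

(** Comparing coefficients in [b (e ^ X - 1) = X] gives the recurrence
    [b_n = [n = 0] - sum_(i < n) b_i / (n + 1 - i)!] for [b_n = B_n / n!]. *)
Let rational_bern j : rational (B j).
Proof.
suff H : rational (B j / j`!%:R).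
  have -> : B j = B j / j`!%:R * j`!%:R.
    by rewrite divfK // pnatr_eq0 -lt0n fact_gt0.
  exact: rationalM.
elim/ltn_ind: j => j IH.
have [e eE] : exists e, e = exp_series R - 1 by eexists.
have e0 : e 0%N = 0 by rewrite eE fpsBE /= fact0 invr1 subrr.
have e1 : e 1%N = 1 by rewrite eE fpsBE /= invr1 subr0.
have re k : rational (e k).
  rewrite eE fpsBE; apply: rationalD; first exact/rationalV/rational_nat.
  exact/rationalN/rational_nat.
have : (bern_series B * e) j.+1 = fX j.+1 by rewrite eE bE.
rewrite fpsME big_ord_recr big_ord_recr /= subnn subSnn e0 e1 mulr0 mulr1 addr0.
move=> h.
have -> : B j / j`!%:R = (j.+1 == 1)%:R - \sum_(i < j) B i / i`!%:R * e (j.+1 - i)%N.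
  by rewrite -h [X in X - _]addrC addrK.
apply: rationalD; first exact: rational_nat.
by apply/rationalN/rational_sum => i _; apply: rationalM => //; exact: IH.
Qed.

Let rational_alpha N : rational (alpha B N).
Proof.
apply: rational_sum => i _; apply: rational_sum => j _.
have rf k : rational ((2 ^+ (2 * k) - 2) * B (2 * k)%N / (2 * k)`!%:R).
  apply/rationalM/rationalV/rational_nat; apply/rationalM/rational_bern.
  by apply: rationalD; [exact/rationalX/rational_nat|exact/rationalN/rational_nat].
apply: rationalM => //; apply: rationalM => //.
by apply/rationalX/rationalN; exact: (rational_nat 1).
Qed.

Lemma rational_coefficient n : rational (\sum_(k < n.+1)
  (2 ^+ (4 * k + 3) * B (4 * k + 2)%N / (4 * k + 2)`!%:R
     * (\sum_(i < (n - k).+1) alpha B (n - k - i) / (4 * i + 2)`!%:R)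
   - alpha B (n - k) / (4 * k + 3)`!%:R)).
Proof.
have rV k : rational (k`!%:R^-1) by exact/rationalV/rational_nat.
apply: rational_sum => k _; apply: rationalD; last first.
  by apply: rationalN; apply: rationalM.
apply: rationalM; last by apply: rational_sum => i _; exact: rationalM.
apply: rationalM => //; apply: rationalM => //.
exact/rationalX/rational_nat.
Qed.

End Value.

Theorem theoremC (R : realType) (B : nat -> R) (hB : bernoulli_numbers B)
    (n : nat) (hn : (0 < n)%N) :
  (\sum_(s <- insertions2 (string31 n)) zeta_star R s)%E =
    ((\sum_(k < n.+1)
        (2 ^+ (4 * k + 3) * B (4 * k + 2)%N / (4 * k + 2)`!%:R
           * (\sum_(i < (n - k).+1) alpha B (n - k - i) / (4 * i + 2)`!%:R)
         - alpha B (n - k) / (4 * k + 3)`!%:R))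
     * pi ^+ (4 * n + 2))%:E
  /\ exists q : rat,
       (\sum_(s <- insertions2 (string31 n)) zeta_star R s)%E
         = (ratr q * pi ^+ (4 * n + 2))%:E.
Proof.
split; first exact: sum_zeta_star.
by have [q qE] := rational_coefficient hB n; exists q; rewrite (sum_zeta_star hB) qE.
Qed.
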